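(* Let $p\ge2$ be real and let $N$ be an integer with $N\ge 1+p(p-1)$. Set $\Lambda_p:=\left(\frac{N-1}{p}\right)^p$ and $r:=\varrho(x,x_0)$ with $x_0\in\mathbb{H}^N$ fixed. Then for all $u\in C_c^\infty(\mathbb{H}^N)$ $$\int_{\mathbb{H}^N}|\nabla_{\mathbb{H}^N}u|^p\,{\rm d}v_{\mathbb{H}^N}-\Lambda_p\int_{\mathbb{H}^N}H_p(r)\,|u|^p\,{\rm d}v_{\mathbb{H}^N}\ \ge\ \frac{(p-1)^{p-1}(N(p-2)+1)}{p^p}\int_{\mathbb{H}^N}\frac{|u|^p}{r^p}\,{\rm d}v_{\mathbb{H}^N}$$ $$\qquad+\ \frac{(N-1)(N-1-p(p-1))(p-1)^{p-2}}{p^p}\int_{\mathbb{H}^N}\frac{|u|^p}{\sinh^p r}\,{\rm d}v_{\mathbb{H}^N},$$ where $$H_p(r)=\left(\coth r-\left(\frac{p-1}{N-1}\right)\frac1r\right)^{p-2}.$$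
   Context: $\mathbb{H}^N$ is the hyperbolic space of dimension $N$ (constant sectional curvature $-1$); $\nabla_{\mathbb{H}^N}$ and ${\rm d}v_{\mathbb{H}^N}$ denote its Riemannian gradient and Riemannian measure, and $|\nabla_{\mathbb{H}^N}u|$ is the Riemannian norm of the gradient. $\varrho(x,x_0)$ is the geodesic distance between $x$ and $x_0$. *)

(* Defs.v *)
From HB Require Import structures.
From mathcomp Require Import all_boot all_order all_algebra.
From mathcomp Require Import all_classical all_reals all_analysis.

Set Implicit Arguments.
Unset Strict Implicit.
Unset Printing Implicit Defensive.

Import Order.TTheory GRing.Theory Num.Theory.
Import numFieldNormedType.Exports.

Local Open Scope classical_set_scope.
Local Open Scope ring_scope.

Section cons_measure.
Context (R : realType) (n : nat).
Local Notation T := (measurableTypeR R).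

Definition cons_pair (z : T * n.-tuple T) : n.+1.-tuple T :=
  [the n.+1.-tuple T of z.1 :: z.2].

Lemma measurable_cons_pair : measurable_fun [set: T * n.-tuple T] cons_pair.
Proof. exact: measurable_cons. Qed.

Variable mu : {sigma_finite_measure set (n.-tuple T) -> \bar R}.

Definition cons_measure : set (n.+1.-tuple T) -> \bar R :=
  pushforward (@lebesgue_measure R \x mu)%E cons_pair.

Let cons_measure0 : cons_measure set0 = 0%E.
Proof. by rewrite /cons_measure /pushforward preimage_set0 measure0. Qed.

Let cons_measure_ge0 A : (0 <= cons_measure A)%E.
Proof. by rewrite /cons_measure /pushforward; apply: measure_ge0. Qed.

Let cons_measure_sigma_additive : semi_sigma_additive cons_measure.
Proof.
move=> F mF tF mUF; rewrite /cons_measure /pushforward preimage_bigcup.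
apply: measure_semi_sigma_additive.
- by move=> i; rewrite -[X in measurable X]setTI; exact: measurable_cons_pair.
- apply/trivIsetP => /= i j _ _ ij; rewrite -preimage_setI.
  by move/trivIsetP : tF => /(_ _ _ _ _ ij) ->//; rewrite preimage_set0.
- rewrite -preimage_bigcup -[X in measurable X]setTI.
  exact: measurable_cons_pair.
Qed.

HB.instance Definition _ := isMeasure.Build _ _ _ cons_measure
  cons_measure0 cons_measure_ge0 cons_measure_sigma_additive.

Let uncons (t : n.+1.-tuple T) : T * n.-tuple T :=
  (thead t, [tuple of behead t]).

Let cons_pairK : cancel cons_pair uncons.
Proof. by case=> x t; rewrite /uncons /cons_pair theadE; congr pair; exact/val_inj. Qed.

Let measurable_uncons : measurable_fun [set: n.+1.-tuple T] uncons.
Proof.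
apply/measurable_fun_pair; first exact: measurable_tnth.
exact: measurable_behead.
Qed.

Let cons_measure_sigma_finite : sigma_finite setT cons_measure.
Proof.
have /sigma_finiteP[F [TF ndF Foo]] := sigma_finiteT (@lebesgue_measure R).
have /sigma_finiteP[G [TG ndG Goo]] := sigma_finiteT mu.
exists (fun i => uncons @^-1` (F i `*` G i)).
  rewrite predeqE => t; split=> // _.
  have [k _ Fk] : (\bigcup_i F i) (thead t) by rewrite -TF.
  have [l _ Gl] : (\bigcup_i G i) [tuple of behead t] by rewrite -TG.
  exists (maxn k l) => //; split.
    by have /subsetPset := ndF _ _ (leq_maxl k l); exact.
  by have /subsetPset := ndG _ _ (leq_maxr k l); exact.
move=> i; have [mF Fi] := Foo i; have [mG Gi] := Goo i; split.
  rewrite -[X in measurable X]setTI; apply: measurable_uncons => //.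
  exact: measurableX.
rewrite /cons_measure /pushforward -comp_preimage.
rewrite (_ : uncons \o cons_pair = id); last by apply/funext => z; exact: cons_pairK.
by rewrite preimage_id product_measure1E// lte_mul_pinfty// ge0_fin_numE.
Qed.

HB.instance Definition _ := Measure_isSigmaFinite.Build _ _ _ cons_measure
  cons_measure_sigma_finite.

End cons_measure.

Fixpoint lebesgue_tuple (R : realType) (n : nat) :
    {sigma_finite_measure set (n.-tuple (measurableTypeR R)) -> \bar R} :=
  match n with
  | 0 => [the {sigma_finite_measure set _ -> \bar R} of dirac [tuple]]
  | n'.+1 => [the {sigma_finite_measure set _ -> \bar R} of
               cons_measure (lebesgue_tuple R n')]
  end.

Lemma lebesgue_tuple_box (R : realType) (n : nat)
    (A : 'I_n -> set (measurableTypeR R)) :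
  (forall i, measurable (A i)) ->
  lebesgue_tuple R n [set t | forall i, A i (tnth t i)] =
  (\prod_(i < n) lebesgue_measure (A i))%E.
Proof.
elim: n A => [|n IH] A mA.
  rewrite big_ord0 /= diracE mem_set//; last by case.
rewrite big_ord_recl /= /cons_measure /pushforward.
rewrite (_ : _ @^-1` _ =
  A ord0 `*` [set t | forall i, A (lift ord0 i) (tnth t i)]).
  rewrite product_measure1E//; first by rewrite (IH (fun i => A (lift ord0 i))).
  rewrite (_ : [set t | _] =
      \big[setI/setT]_(i < n) ((@tnth n _ ^~ i) @^-1` A (lift ord0 i))).
    apply: bigsetI_measurable => i _; rewrite -[X in measurable X]setTI.
    exact: measurable_tnth.
  apply/seteqP; split=> t.
    by move=> At; rewrite -bigcap_seq => i _; exact: At.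
  by rewrite -bigcap_seq => At i; apply: At; rewrite /= mem_index_enum.
apply/seteqP; split=> -[x t] /=.
  move=> At; split; first exact: (At ord0).
  by move=> i; have := At (lift ord0 i); rewrite tnthS; congr (A _ (tnth _ _)); exact/val_inj.
move=> [Ax At] i; case: (unliftP ord0 i) => [j|] ->; last by [].
by rewrite tnthS; have := At j; congr (A _ (tnth _ _)); exact/val_inj.
Qed.

(* [g x] is the Gram matrix at [x] of a Riemannian metric on the open set [U] of
   R^n; tangent vectors are row vectors. *)

Section riemannian.
Context (R : realType) (n : nat).
Implicit Types (U : set 'rV[R]_n) (g : 'rV[R]_n -> 'M[R]_n) (x y v w : 'rV[R]_n).
Implicit Types (u f : 'rV[R]_n -> R) (c : R -> 'rV[R]_n).

Definition riem_inner g x v w : R := (v *m g x *m w^T) ord0 ord0.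

Definition riem_norm g x v : R := Num.sqrt (riem_inner g x v v).

Definition partials u x : 'rV[R]_n := \row_i 'D_(delta_mx ord0 i) u x.

Definition riem_grad g u x : 'rV[R]_n := partials u x *m invmx (g x).

(* Integral over [U] for the Riemannian measure, of density [sqrt (det g)] with
   respect to the Lebesgue measure. *)
Definition riem_integral U g f : \bar R :=
  (\int[lebesgue_tuple R n]_(t in [set t | U (\row_i tnth t i)])
     (f (\row_i tnth t i) * Num.sqrt (\det (g (\row_i tnth t i))))%:E)%E.

Definition riem_length g c : R :=
  (\int[@lebesgue_measure R]_(t in `[0%R, 1%R]) riem_norm g (c t) (derive1 c t))%R.

(* A C^1 curve on [0, 1] is given as the restriction of a C^1 curve on R.
   Allowing piecewise C^1 curves would not change the set of lengths: a
   reparametrization which stops at the break points makes them C^1. *)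
Definition C1_path U x y c : Prop :=
  [/\ (forall t, derivable c t 1), continuous (derive1 c),
      c 0 = x, c 1 = y & forall t, 0 <= t <= 1 -> U (c t)].

Definition riem_dist U g x y : R :=
  inf [set riem_length g c | c in [set c | C1_path U x y c]].

(* C^oo: every iterated directional derivative (of any order, including 0) is
   differentiable, hence continuous. *)
Definition smooth u : Prop :=
  forall (vs : seq 'rV[R]_n) x,
    differentiable (foldr (fun v h => fun z => 'D_v h z) u vs) x.

(* Elements of C_c^oo(U), extended by 0 outside [U]. *)
Definition test_function U u : Prop :=
  [/\ smooth u, compact (closure [set x | u x != 0])
    & closure [set x | u x != 0] `<=` U].

End riemannian.

Section hyperbolic_space.
Context (R : realType) (n : nat).
Implicit Types (x y : 'rV[R]_n) (u f : 'rV[R]_n -> R).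

(* The norm of ['rV[R]_n] in the library is the sup norm, whence [sqnorm]. *)
Definition sqnorm x : R := \sum_(i < n) x ord0 i ^+ 2.

Definition hyp_space : set 'rV[R]_n := [set x | sqnorm x < 1].

(* Poincare ball model: 4 |dx|^2 / (1 - |x|^2)^2, of curvature -1. *)
Definition hyp_metric x : 'M[R]_n := (4 / (1 - sqnorm x) ^+ 2)%:M.

Definition hyp_dist : 'rV[R]_n -> 'rV[R]_n -> R := riem_dist hyp_space hyp_metric.

Definition hyp_integral : ('rV[R]_n -> R) -> \bar R :=
  riem_integral hyp_space hyp_metric.

Definition hyp_grad_norm u x : R :=
  riem_norm hyp_metric x (riem_grad hyp_metric u x).

End hyperbolic_space.

Section hyperbolic_functions.
Context (R : realType).
Implicit Types r : R.

Definition sinh r : R := (expR r - expR (- r)) / 2.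
Definition cosh r : R := (expR r + expR (- r)) / 2.
Definition coth r : R := cosh r / sinh r.

End hyperbolic_functions.

Definition hardy_weight (R : realType) (p : R) (N : nat) (r : R) : R :=
  (coth r - (p - 1) / (N%:R - 1) * r^-1) `^ (p - 2).

(* Main.v *)
Require Import Defs.
From mathcomp Require Import all_boot all_order all_algebra.
From mathcomp Require Import all_classical all_reals all_analysis.
From mathcomp Require Import measurable_realfun.
From mathcomp Require Import ring lra.

(** The inequality comes from a supersolution turned into a vector field.  Let [r] be
    the distance to [x0], let [phi = r^((p-1)/p) (sinh r)^(-(N-1)/p)], and put
    [h = - phi' / phi], that is, [p h = (N-1) coth r - (p-1) / r].  The radial field
    [V = h^(p-1) d/dr] satisfies

      [div V - (p-1) |V|^(p/(p-1)) >= W],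

    where [W] is the sum of the three weights of the theorem with their constants
    ([hardy_sum_le]); the hypothesis on [N] makes the constants nonnegative and gives
    [h] the lower bounds needed.  If [div (|u|^p V)] had integral zero, Young's inequality
    [p |u|^(p-1) |grad u| |V| <= |grad u|^p + (p-1) |u|^p |V|^(p/(p-1))] would yield
    [int |grad u|^p >= int W |u|^p], which is the claim.

    The field is singular at [x0], so it is multiplied by a cut-off [cut n] that
    vanishes near [x0].  Since [cut n] is a nondecreasing function of [r] and [V] points
    outwards, the derivative of the cut-off contributes a nonnegative term to the
    divergence and can be dropped ([flux_ineq]): no estimate on the volume of small balls
    is involved.  Then [n] tends to infinity by monotone convergence
    ([hardy_integral_le]).  All three weighted terms are nonnegative and their sum is at
    most the finite energy, so each of them is finite and may be moved across the
    inequality between extended reals.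

    Everything is computed in the ball with the variable [q = cosh r], a rational function
    of the coordinates whose Riemannian gradient is a polynomial field [grad_cosh], with
    [|grad q|^2 = q^2 - 1] ([conf_grad_cosh]) and Laplacian [N q] ([laplace_cosh]).  With
    [V] written as [profile q] times [grad q], the divergence of [cut n |u|^p V] is an
    algebraic identity ([sum_field_deriv]); its integral vanishes because each partial
    derivative of a compactly supported C^1 function integrates to zero over its
    coordinate ([integral_partial_eq0]).

    The distance is an infimum of lengths, and the weight [coth r - ((p-1)/(N-1)) / r] is
    not a monotone function of [r] in general, so bounds on the distance do not suffice:
    [hyp_distE] identifies it as [acosh q].  One direction is
    [|dq| <= sinh r |dx|] integrated along a curve ([acosh_le_length]); for the other,
    [hyp_line] is a geodesic of the hyperboloid projected to the ball. *)

Set Implicit Arguments.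
Unset Strict Implicit.
Unset Printing Implicit Defensive.

Import Order.TTheory GRing.Theory Num.Theory.
Import numFieldNormedType.Exports.

Local Open Scope classical_set_scope.
Local Open Scope ring_scope.

(** * Measurability and integration on real tuples *)

Section tuple_measurability.
Context (R : realType) (n : nat).
Local Notation T := (measurableTypeR R).

Definition row_of (t : n.-tuple T) : 'rV[R]_n := \row_i tnth t i.

Lemma measurable_box (A : 'I_n -> set T) : (forall i, measurable (A i)) ->
  measurable [set t : n.-tuple T | forall i, A i (tnth t i)].
Proof.
move=> mA; rewrite (_ : [set t | _] =
    \big[setI/setT]_(i < n) ((@tnth n _ ^~ i) @^-1` A i)).
  apply: bigsetI_measurable => i _; rewrite -[X in measurable X]setTI.
  exact: measurable_tnth.
apply/seteqP; split=> t.
  by move=> At; rewrite -bigcap_seq => i _; exact: At.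
by rewrite -bigcap_seq => At i; apply: At; rewrite /= mem_index_enum.
Qed.

(** The sigma-algebra on tuples is the product one, whereas openness of [U]
    refers to the norm topology of row vectors: an open set is the union of the
    countably many boxes it contains with rational centre and radius
    [1/(k+1)]. *)
Lemma measurable_row_of_open (U : set 'rV[R]_n) : open U ->
  measurable (row_of @^-1` U).
Proof.
move=> oU.
pose qbox (c : 'rV[rat]_n * nat) : set 'rV[R]_n :=
  [set x | forall i, ball (ratr (c.1 ord0 i) : R) c.2.+1%:R^-1 (x ord0 i)].
pose F c := if `[< qbox c `<=` U >] then row_of @^-1` qbox c else set0.
rewrite (_ : _ @^-1` _ = \bigcup_c F c).
  apply: countable_bigcupT_measurable => [|c].
    exact: countableP.
  rewrite /F; case: ifP => // _.
  rewrite (_ : _ @^-1` _ = [set t : n.-tuple T | forall i,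
     ball (ratr (c.1 ord0 i) : R) c.2.+1%:R^-1 (tnth t i)]); last first.
    by apply/seteqP; split=> t /= + i => /(_ i); rewrite mxE.
  apply: (measurable_box (A := fun i => ball (ratr (c.1 ord0 i) : R) _)) => i.
  exact: measurable_ball.
apply/seteqP; split => [t Ut|t [c _]]; last first.
  by rewrite /F; case: ifPn => // /asboolP cU; exact: cU.
have /nbhs_ballP[e /= e0 eU] : nbhs (row_of t) U by exact: open_nbhs_nbhs.
have [k] : exists k : nat, 0 + k.+1%:R^-1 < e / 2.
  by apply: ltr_add_invr; rewrite divr_gt0.
rewrite add0r => ke.
have qex i : exists q : rat, ball (ratr q : R) k.+1%:R^-1 (tnth t i).
  have k0 : (0 : R) < k.+1%:R^-1 by rewrite invr_gt0.
  move: k0; set d := k.+1%:R^-1 => k0; set ti : R := tnth t i.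
  have /rat_in_itvoo[q] : ti - d < ti + d by lra.
  rewrite in_itv/= => /andP[q1 q2]; exists q.
  by rewrite /ball/= ltr_norml; apply/andP; split; lra.
(* Radius [1/(k+1)] below [e/2]: two triangle inequalities stay within [e]. *)
pose c : 'rV[rat]_n * nat := (\row_i sval (cid (qex i)), k).
exists c => //; rewrite /F asboolT.
  by move=> i; rewrite !mxE /=; exact: svalP (cid (qex i)).
move=> x cx; apply: eU; split => // i j; rewrite ord1.
have := cx j; rewrite /c /= !mxE => h1.
have h2 := svalP (cid (qex j)).
rewrite (splitr e); apply: (@ball_triangle _ _ (ratr (sval (cid (qex j))) : R)).
  by apply: ball_sym; apply: le_ball h2; exact: ltW.
by apply: le_ball h1; exact: ltW.
Qed.

Lemma measurable_row_of_continuous (f : 'rV[R]_n -> R) : continuous f ->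
  measurable_fun [set: n.-tuple T] (f \o row_of).
Proof.
move=> /continuousP cf; apply: (measurability _ (RGenOpens.measurableE R)).
move=> _ [_ [a [b ->] <-]]; rewrite setTI comp_preimage.
by apply: measurable_row_of_open; exact/cf/interval_open.
Qed.

End tuple_measurability.

Section box_supported.
Context (R : realType).
Local Notation T := (measurableTypeR R).

(** The class on which the slice-by-slice argument below runs: it implies
    integrability and, unlike integrability, is inherited by every section
    [t |-> G (x :: t)]. *)
Definition box_supported n (G : n.-tuple T -> R) :=
  [/\ measurable_fun setT G, exists M, forall t, `|G t| <= M
    & exists B, forall t i, B < `|tnth t i| -> G t = 0].

Lemma bounded_supp_integrable d (X : measurableType d)
    (mu : {measure set X -> \bar R}) (A : set X) (G : X -> R) (M : R) :
  measurable A -> (mu A < +oo)%E -> measurable_fun setT G ->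
  (forall x, `|G x| <= M) -> (forall x, ~ A x -> G x = 0) ->
  mu.-integrable setT (EFin \o G).
Proof.
move=> mA Aoo mG GM G0.
rewrite (_ : EFin \o G = (EFin \o G) \_ A).
  apply/(integrable_mkcond (EFin \o G) mA).1; apply: measurable_bounded_integrable => //.
    exact: measurable_funTS.
  exists M; split; first exact: num_real.
  by move=> x Mx y _ /=; rewrite (le_trans (GM y))// ltW.
apply/funext => x; rewrite patchE; case: ifPn => //.
by rewrite notin_setE => /G0 /= ->.
Qed.

Lemma lebesgue_tuple_itv_lty n (B : R) :
  (lebesgue_tuple R n [set t | forall i, `[(- B)%R, B]%classic (tnth t i)] < +oo)%E.
Proof.
rewrite (@lebesgue_tuple_box R n (fun=> `[(- B)%R, B]%classic))//.
suff /andP[] : (0 <= \prod_(i < n) lebesgue_measure (`[(- B)%R, B]%classic : set T) < +oo)%E by [].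
apply: (big_ind (fun x => (0 <= x < +oo)%E)) => //=.
- by rewrite lee_fin ler01 ltry.
- move=> x y /andP[x0 xoo] /andP[y0 yoo]; rewrite mule_ge0//= lte_mul_pinfty//.
  by rewrite ge0_fin_numE.
move=> i _; rewrite measure_ge0/= lebesgue_measure_itv/=.
by case: ifPn => // _; rewrite -EFinB ltry.
Qed.

Lemma box_supported_integrable n (G : n.-tuple T -> R) : box_supported G ->
  (lebesgue_tuple R n).-integrable setT (EFin \o G).
Proof.
case=> mG [M GM] [B GB].
apply: (bounded_supp_integrable _ (lebesgue_tuple_itv_lty n B) mG GM) => [|t].
  exact: (measurable_box (A := fun=> `[- B, B]%classic)).
move=> /existsNP[i /negP tiB]; apply: (GB t i); move: tiB.
by rewrite /= in_itv/= -ler_norml -ltNge.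
Qed.

Lemma tnth_cons_pair_lift n x (t : n.-tuple T) j :
  tnth (cons_pair (x, t)) (lift ord0 j) = tnth t j.
Proof. by rewrite tnthS; congr tnth; exact/val_inj. Qed.

Lemma box_supported_cons n (G : n.+1.-tuple T -> R) (x : T) :
  box_supported G -> box_supported (fun t => G (cons_pair (x, t))).
Proof.
case=> mG [M GM] [B GB]; split; first 2 last.
- exists B => t i Bti; apply: (GB _ (lift ord0 i)).
  by rewrite tnth_cons_pair_lift.
- apply: (measurableT_comp mG); apply: (measurableT_comp (@measurable_cons_pair R n)).
  exact: measurable_pair1.
- by exists M => t.
Qed.

Lemma box_supported_prod_integrable n (G : n.+1.-tuple T -> R) : box_supported G ->
  (@lebesgue_measure R \x lebesgue_tuple R n)%E.-integrable setT
    (EFin \o (G \o @cons_pair R n)).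
Proof.
case=> mG [M GM] [B GB].
pose A : set (n.+1.-tuple T) := [set t | forall i, `[- B, B]%classic (tnth t i)].
apply: (@bounded_supp_integrable _ _ _ (@cons_pair R n @^-1` A) _ M).
- rewrite -[X in measurable X]setTI; apply: measurable_cons_pair => //.
  exact: (measurable_box (A := fun=> `[- B, B]%classic)).
- exact: (lebesgue_tuple_itv_lty n.+1 B).
- exact: measurableT_comp mG (@measurable_cons_pair R n).
- by move=> x; exact: GM.
move=> t /existsNP[i /negP tiB]; apply: (GB (cons_pair t) i); move: tiB.
by rewrite /= in_itv/= -ler_norml -ltNge.
Qed.

Lemma integral_lebesgue_tuple_cons n (G : n.+1.-tuple T -> R) :
  box_supported G ->
  (\int[lebesgue_tuple R n.+1]_t (G t)%:E =
   \int[@lebesgue_measure R \x lebesgue_tuple R n]_z (G (cons_pair z))%:E)%E.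
Proof.
move=> bG; rewrite /= /cons_measure integral_pushforward//.
- exact: measurable_cons_pair.
- by apply/measurable_EFinP; case: bG.
- by rewrite preimage_setT; exact: (box_supported_prod_integrable bG).
Qed.

Definition set_coord n (t : n.-tuple T) (i : 'I_n) (s : T) : n.-tuple T :=
  [tuple if j == i then s else tnth t j | j < n].

(** Fubini along the [i]-th coordinate.  The measure on tuples is built by
    consing one coordinate at a time, so coordinate [0] is integrated first in
    one of the two orders of integration, and coordinate [j+1] is coordinate
    [j] of the tail, reached by induction. *)
Lemma integral_lebesgue_tuple_slice0 n (G : n.-tuple T -> R) (i : 'I_n) :
  box_supported G ->
  (forall t, \int[@lebesgue_measure R]_s (G (set_coord t i s))%:E = 0)%E ->
  (\int[lebesgue_tuple R n]_t (G t)%:E = 0)%E.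
Proof.
elim: n G i => [G []//|n IH] G i bG G0.
rewrite integral_lebesgue_tuple_cons//.
have iG := box_supported_prod_integrable bG.
case: (unliftP ord0 i) => [j ij|i0].
  rewrite -(integral12_prod_meas1 iG)/=.
  rewrite integral0_eq// => x _.
  apply: (IH (fun t => G (cons_pair (x, t))) j); first exact: box_supported_cons.
  move=> t; rewrite -[RHS](G0 (cons_pair (x, t))); apply: eq_integral => s _.
  congr (G _)%:E; apply: eq_from_tnth => k; rewrite tnth_mktuple.
  case: (unliftP ord0 k) => [k'|] ->.
    rewrite ij (inj_eq lift_inj) !tnth_cons_pair_lift tnth_mktuple.
    by [].
  by rewrite ij.
rewrite -(integral21_prod_meas1 iG)/=.
rewrite integral0_eq// => t _.
rewrite -[RHS](G0 (cons_pair (0, t))); apply: eq_integral => s _.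
congr (G _)%:E; apply: eq_from_tnth => k; rewrite tnth_mktuple.
case: (unliftP ord0 k) => [k'|] ->; rewrite i0 ?tnth_cons_pair_lift//.
Qed.
End box_supported.

(** * The divergence theorem for compactly supported fields *)

Section compact_bounds.
Context (R : realType).

Lemma compact_norm_bounded (T : topologicalType) (f : T -> R) (K : set T) :
  compact K -> {within K, continuous f} ->
  exists M, forall x, K x -> `|f x| <= M.
Proof.
move=> cK cf; have [->|K0] := eqVneq K set0; first by exists 0.
have [] := @compact_EVT_max _ _ (fun x => `|f x|) K.
- exact/set0P.
- by [].
- move=> x; apply: (@continuous_comp _ _ _ (f : subspace K -> R)).
    exact: cf.
  exact: norm_continuous.
- by move=> c _ Kc; exists `|f c| => x Kx; apply: Kc; rewrite inE.
Qed.

Lemma coord_le_norm n (x : 'rV[R]_n) i : `|x ord0 i| <= `|x|.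
Proof.
by rewrite [leRHS]/Num.Def.normr/= mx_normrE; exact: (le_bigmax _ _ (ord0, i)).
Qed.
End compact_bounds.

Section divergence.
Context (R : realType) (n : nat).
Implicit Types (F f : 'rV[R]_n -> R) (K : set 'rV[R]_n).
Local Notation T := (measurableTypeR R).

Lemma box_supported_row_of f K : continuous f -> compact K ->
  (forall x, ~ K x -> f x = 0) -> box_supported (f \o @row_of R n).
Proof.
move=> cf cK f0; split; first exact: measurable_row_of_continuous.
  have [M KM] := compact_norm_bounded cK (continuous_subspaceT cf).
  exists (Num.max M 0) => t; have [Kt|/f0 ft] := pselect (K (row_of t)).
    by rewrite le_max KM.
  by rewrite /= ft normr0 le_max lexx orbT.
have [B KB] := compact_norm_bounded cK (continuous_subspaceT (@norm_continuous R 'rV[R]_n)).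
exists B => t i Bti; apply: f0 => /KB; apply/negP; rewrite -ltNge normr_id.
by rewrite (lt_le_trans Bti)// (le_trans _ (coord_le_norm _ i))// mxE.
Qed.

Lemma is_derive_line F x v s d :
  is_derive (x + s *: v) v F d ->
  is_derive s 1 (fun s : R => F (x + s *: v)) d.
Proof.
have E : (fun h : R => h^-1 *: (F (h *: v + (x + s *: v)) - F (x + s *: v))) =
    (fun h : R => h^-1 *: (F (x + (h *: (1 : R) + s) *: v) - F (x + s *: v))).
  apply/funext => h; congr (_ *: (F _ - _)).
  by rewrite [h *: 1]mulr1 scalerDl addrCA.
case=> dF <-; split.
  by move: dF; rewrite /derivable E.
by rewrite /derive E.
Qed.

Lemma integral_derivative_compact_supp (g g' : R -> R) (B : R) :
  continuous g' -> (forall s : R, is_derive s 1 g (g' s)) ->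
  (forall s, B < `|s| -> g s = 0 /\ g' s = 0) ->
  (\int[@lebesgue_measure R]_s (g' s)%:E = 0)%E.
Proof.
move=> cg' dg g0.
pose b := `|B| + 1.
have Bb : B < b by rewrite ltr_pwDr// ler_norm.
have b0 : 0 < b by rewrite ltr_wpDl.
transitivity (\int[@lebesgue_measure R]_(s in `[(- b)%R, b]) (g' s)%:E)%E.
  rewrite [RHS]integral_mkcond; apply: eq_integral => s _; rewrite patchE.
  case: ifPn => //; rewrite notin_setE /= in_itv/= -ler_norml => /negP.
  by rewrite -ltNge => bs; rewrite (g0 s _).2// (lt_trans Bb).
rewrite (@continuous_FTC2 _ _ g).
- by rewrite !(g0 _ _).1 ?subee// ?normrN gtr0_norm.
- by lra.
- exact: continuous_subspaceT.
- have cg : continuous g.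
    move=> s; apply: differentiable_continuous; apply/derivable1_diffP.
    exact: ex_derive.
  split => [s _||]; first exact: ex_derive.
  + by apply: cvg_at_right_filter; exact: cg.
  + by apply: cvg_at_left_filter; exact: cg.
- by move=> s _; rewrite derive1E; exact: derive_val.
Qed.

(** Every line in direction [e_i] carries a C^1 function of compact support, whose
    derivative has integral zero by the fundamental theorem of calculus; Fubini
    does the rest. *)
Theorem integral_partial_eq0 F f K (i : 'I_n) : continuous f -> compact K ->
  (forall x, ~ K x -> F x = 0 /\ f x = 0) ->
  (forall x, is_derive x (delta_mx ord0 i : 'rV[R]_n) F (f x)) ->
  (\int[lebesgue_tuple R n]_t (f (row_of t))%:E = 0)%E.
Proof.
move=> cf cK F0 dF.
have bf : box_supported (f \o @row_of R n).
  by apply: (box_supported_row_of cf cK) => x /F0[].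
apply: (integral_lebesgue_tuple_slice0 (G := f \o @row_of R n) (i := i) bf) => t /=.
pose x0 := row_of (set_coord t i 0); pose e : 'rV[R]_n := delta_mx ord0 i.
have rowE s : row_of (set_coord t i s) = x0 + s *: e.
  apply/rowP => j; rewrite !mxE !tnth_mktuple eqxx/=.
  by case: (j == i); rewrite ?mulr1 ?mulr0 ?add0r ?addr0.
under eq_integral do rewrite rowE.
have [B KB] := compact_norm_bounded cK (continuous_subspaceT (@norm_continuous R 'rV[R]_n)).
apply: (@integral_derivative_compact_supp (fun s => F (x0 + s *: e)) _ B).
- move=> s; apply: continuous_comp; last exact: cf.
  apply: cvgD; first exact: cvg_cst.
  exact: scalel_continuous.
- by move=> s; apply: is_derive_line.
- move=> s Bs; apply: F0 => /KB; apply/negP; rewrite -ltNge normr_id.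
  rewrite (lt_le_trans Bs)// (le_trans _ (coord_le_norm _ i))//.
  by rewrite !mxE !tnth_mktuple !eqxx/= mulr1 add0r.
Qed.
End divergence.

(** * Calculus in the Poincare ball *)

Section directional_derivatives.
Context (R : realType) (V : normedModType R).
Implicit Types (f : V -> R) (x v : V).

Lemma is_derive_alongP f x v d :
  is_derive x v f d <-> is_derive (0 : R) 1 (fun h : R => f (h *: v + x)) d.
Proof.
have E : (fun h : R => h^-1 *: (f (h *: v + x) - f x)) =
    (fun h : R => h^-1 *: (f ((h *: (1 : R) + 0) *: v + x) - f (0 *: v + x))).
  by apply/funext => h; rewrite addr0 scale0r add0r [_%:A]mulr1.
by split=> -[df <-]; split; rewrite ?/derive ?E//; move: df; rewrite /derivable E.
Qed.

Lemma is_derive_comp1 (g : R -> R) f x v a b :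
  is_derive (f x) 1 g a -> is_derive x v f b -> is_derive x v (g \o f) (a * b).
Proof.
move=> dg /is_derive_alongP df; apply/is_derive_alongP.
apply: (@is_derive1_comp _ g (fun h : R => f (h *: v + x))) => //.
by rewrite scale0r add0r.
Qed.

Lemma is_derive_mul f g x v df dg :
  is_derive x v f df -> is_derive x v g dg ->
  is_derive x v (fun y => f y * g y) (df * g x + f x * dg).
Proof.
move=> hf hg; have := is_deriveM hf hg; move=> h; apply: (is_derive_eq h).
by rewrite /GRing.scale/= addrC [g x * _]mulrC.
Qed.

Lemma is_derive_inv f x v df : is_derive x v f df -> f x != 0 ->
  is_derive x v (fun y => (f y)^-1) (- df / f x ^+ 2).
Proof.
move=> [hf <-] fx0; split; first exact: derivableV.
by rewrite deriveV// /GRing.scale/= !mulNr mulrC.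
Qed.

Lemma is_derive_cvg (g : R -> R) (q dg : R) :
  is_derive q 1 g dg -> g z @[z --> q] --> g q.
Proof.
by case=> hg _; apply: (@differentiable_continuous _ _ _ q g); exact/derivable1_diffP.
Qed.
End directional_derivatives.

Section poincare_ball.
Context (R : realType) (n : nat).
Implicit Types (x y a w : 'rV[R]_n).

Definition dot x y : R := \sum_(i < n) x ord0 i * y ord0 i.

Lemma dotxx x : dot x x = sqnorm x.
Proof. by apply: eq_bigr => i _; rewrite expr2. Qed.

Lemma dotC x y : dot x y = dot y x.
Proof. by apply: eq_bigr => i _; rewrite mulrC. Qed.

Lemma dotDl x y z : dot (x + y) z = dot x z + dot y z.
Proof. by rewrite -big_split; apply: eq_bigr => i _; rewrite mxE mulrDl. Qed.

Lemma dotZl c x z : dot (c *: x) z = c * dot x z.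
Proof. by rewrite mulr_sumr; apply: eq_bigr => i _; rewrite mxE mulrA. Qed.

Lemma dotDr x y z : dot x (y + z) = dot x y + dot x z.
Proof. by rewrite dotC dotDl !(dotC x). Qed.

Lemma dotZr c x z : dot x (c *: z) = c * dot x z.
Proof. by rewrite dotC dotZl dotC. Qed.

Lemma dotBl x y z : dot (x - y) z = dot x z - dot y z.
Proof. by rewrite -scaleN1r dotDl dotZl mulN1r. Qed.

Lemma dot_delta x i : dot x (delta_mx ord0 i) = x ord0 i.
Proof.
rewrite /dot (bigD1 i)//= big1 ?addr0 => [|j ji].
  by rewrite mxE !eqxx mulr1.
by rewrite mxE (negbTE ji) andbF mulr0.
Qed.

Lemma sqnorm_ge0 x : 0 <= sqnorm x.
Proof. by apply: sumr_ge0 => i _; exact: sqr_ge0. Qed.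

Lemma sqnorm_eq0 x : (sqnorm x == 0) = (x == 0).
Proof.
apply/idP/eqP => [|->]; last by rewrite /sqnorm big1// => i _; rewrite mxE expr0n.
rewrite psumr_eq0 => [/allP x0|i _]; last exact: sqr_ge0.
apply/rowP => i; rewrite mxE; apply/eqP.
by rewrite -sqrf_eq0; apply: x0; rewrite mem_index_enum.
Qed.

Lemma sqnormZ c x : sqnorm (c *: x) = c ^+ 2 * sqnorm x.
Proof. by rewrite -!dotxx dotZl dotZr mulrA expr2. Qed.

Lemma sqnormD x y : sqnorm (x + y) = sqnorm x + 2 * dot x y + sqnorm y.
Proof. by rewrite -!dotxx dotDl !dotDr (dotC y x); ring. Qed.

Lemma sqnormB x y : sqnorm (x - y) = sqnorm x - 2 * dot x y + sqnorm y.
Proof. by rewrite sqnormD -scaleN1r dotZr sqnormZ; ring. Qed.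

Lemma sqnorm_comb c d x y : sqnorm (c *: x + d *: y) =
  c ^+ 2 * sqnorm x + 2 * c * d * dot x y + d ^+ 2 * sqnorm y.
Proof. by rewrite sqnormD !sqnormZ dotZl dotZr; ring. Qed.

Lemma dot_comb c d x y z : dot (c *: x + d *: y) z = c * dot x z + d * dot y z.
Proof. by rewrite dotDl !dotZl. Qed.

Lemma cauchy_schwarz x y : dot x y ^+ 2 <= sqnorm x * sqnorm y.
Proof.
have [->|y0] := eqVneq y 0.
  by rewrite -(scale0r 0) dotZr mul0r expr0n/= mulr_ge0 ?sqnorm_ge0.
have Y0 : 0 < sqnorm y by rewrite lt_def sqnorm_eq0 y0 sqnorm_ge0.
have := sqnorm_ge0 (sqnorm y *: x - dot x y *: y).
rewrite sqnormB !sqnormZ dotZl dotZr.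
rewrite (_ : _ + _ = sqnorm y * (sqnorm x * sqnorm y - dot x y ^+ 2)); last ring.
by rewrite pmulr_rge0// subr_ge0.
Qed.

Lemma is_derive_coord (V : normedModType R) (c : V -> 'rV[R]_n) (s v : V) w i :
  is_derive s v c w -> is_derive s v (fun y : V => c y ord0 i) (w ord0 i).
Proof.
case=> dc <-; split; first exact: ((derivable_mxP c s v).1 dc).
by have /rowP/(_ i) := derive_mx dc; rewrite mxE => ->.
Qed.

Lemma is_derive_row (V : normedModType R) (c : V -> 'rV[R]_n) (s v : V) w :
  (forall i, is_derive s v (fun y : V => c y ord0 i) (w ord0 i)) ->
  is_derive s v c w.
Proof.
move=> dc; have hc : derivable c s v.
  by apply/derivable_mxP => i j; rewrite ord1; exact: ex_derive.
split=> //; rewrite derive_mx//; apply/rowP => i; rewrite mxE.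
exact: derive_val.
Qed.

Lemma is_derive_sqnormB (V : normedModType R) (c : V -> 'rV[R]_n) a (s v : V) w :
  is_derive s v c w ->
  is_derive s v (fun y : V => sqnorm (c y - a)) (2 * dot (c s - a) w).
Proof.
move=> hc; rewrite (_ : (fun y : V => _) =
    \sum_(i < n) ((fun y : V => c y ord0 i) - cst (a ord0 i)) ^+ 2); last first.
  apply/funext => y; rewrite fct_sumE; apply: eq_bigr => i _.
  by rewrite !mxE !fctE.
have dc i := is_derive_coord i hc.
apply: is_derive_eq.
rewrite mulr_sumr; apply: eq_bigr => i _.
by rewrite /GRing.scale/= !mxE !fctE/= expr1 subr0; ring.
Qed.

Lemma is_derive_sqnorm (V : normedModType R) (c : V -> 'rV[R]_n) (s v : V) w :
  is_derive s v c w ->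
  is_derive s v (fun y : V => 1 - sqnorm (c y)) (- (2 * dot (c s) w)).
Proof.
move=> /(is_derive_sqnormB 0); rewrite subr0.
rewrite (_ : (fun y : V => _) = fun y : V => sqnorm (c y)); last first.
  by apply/funext => y; rewrite subr0.
move=> h; apply: (is_derive_eq (is_deriveB (is_derive_cst (1 : R) s v) h)).
by rewrite sub0r.
Qed.

(** The hyperbolic cosine of the distance from [a] to [x].  All of the analysis is
    carried out in this variable, which, unlike the distance, is a rational
    function of the coordinates and smooth at [a]. *)
Definition hyp_cosh a x : R :=
  1 + 2 * sqnorm (x - a) / ((1 - sqnorm x) * (1 - sqnorm a)).

(** The Riemannian gradient of [hyp_cosh a]: the inverse metric cancels the
    denominator and leaves a polynomial field. *)
Definition grad_cosh a x : 'rV[R]_n :=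
  (1 - sqnorm a)^-1 *: ((1 - sqnorm x) *: (x - a) + sqnorm (x - a) *: x).

(** The conformal factor: the metric is [conf x ^+ 2] times the Euclidean one, and
    the volume density is [conf x ^+ n]. *)
Definition conf x : R := 2 / (1 - sqnorm x).

Lemma hyp_spaceP x : hyp_space x -> 0 < 1 - sqnorm x.
Proof. by rewrite /hyp_space/= subr_gt0. Qed.

Lemma hyp_cosh_ge1 a x : hyp_space a -> hyp_space x -> 1 <= hyp_cosh a x.
Proof.
move=> /hyp_spaceP a1 /hyp_spaceP x1; rewrite /hyp_cosh lerDl.
by rewrite divr_ge0 ?mulr_ge0 ?sqnorm_ge0// ltW.
Qed.

Lemma hyp_cosh_eq1 a x : hyp_space a -> hyp_space x ->
  (hyp_cosh a x == 1) = (x == a).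
Proof.
move=> /hyp_spaceP a1 /hyp_spaceP x1; rewrite /hyp_cosh.
rewrite -[X in _ == X]addr0 (inj_eq (addrI _)) !mulf_eq0 invr_eq0 mulf_eq0.
by rewrite !(gt_eqF a1, gt_eqF x1) pnatr_eq0 /= orbF sqnorm_eq0 subr_eq0.
Qed.

Lemma is_derive_hyp_cosh (V : normedModType R) (c : V -> 'rV[R]_n) a (s v : V) w :
  hyp_space a -> hyp_space (c s) -> is_derive s v c w ->
  is_derive s v (fun y : V => hyp_cosh a (c y))
    (conf (c s) ^+ 2 * dot (grad_cosh a (c s)) w).
Proof.
move=> /hyp_spaceP a1 /hyp_spaceP x1 dc.
have dI := is_derive_inv (is_derive_sqnorm dc) (lt0r_neq0 x1).
have dM := is_derive_mul (is_derive_sqnormB a dc) dI.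
have := is_deriveD (is_derive_cst (1 : R) s v)
  (is_deriveZ (2 / (1 - sqnorm a)) dM).
rewrite (_ : cst 1 + _ = fun y : V => hyp_cosh a (c y)); last first.
  apply/funext => y; rewrite /hyp_cosh fctE/= /GRing.scale/= invfM; ring.
move=> h; apply: (is_derive_eq h); rewrite /conf /grad_cosh dotZl dot_comb /GRing.scale/=.
field; lra.
Qed.

(** [|grad cosh r|^2 = sinh^2 r], in other words [|grad r| = 1]. *)
Lemma conf_grad_cosh a x : hyp_space a -> hyp_space x ->
  conf x ^+ 2 * sqnorm (grad_cosh a x) = hyp_cosh a x ^+ 2 - 1.
Proof.
move=> /hyp_spaceP a1 /hyp_spaceP x1.
rewrite /conf /grad_cosh /hyp_cosh sqnormZ sqnorm_comb.
rewrite dotBl dotxx sqnormB (dotC a x).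
field; lra.
Qed.

Lemma is_derive_grad_cosh a x i :
  is_derive x (delta_mx ord0 i : 'rV[R]_n) (fun y => grad_cosh a y ord0 i)
    ((1 - sqnorm x + sqnorm (x - a)) / (1 - sqnorm a)).
Proof.
pose e : 'rV[R]_n := delta_mx ord0 i.
have dS := is_derive_sqnorm (@is_derive_id _ _ x e).
have dc : is_derive x e (fun y => y ord0 i - a ord0 i) (e ord0 i).
  have := is_deriveB (is_derive_coord i (@is_derive_id _ _ x e)) (is_derive_cst (a ord0 i) x e).
  by move=> h; apply: (is_derive_eq h); rewrite subr0.
have dD := is_derive_sqnormB a (@is_derive_id _ _ x e).
rewrite (_ : (fun y => _) = fun y => (1 - sqnorm a)^-1 *
    ((1 - sqnorm y) * (y ord0 i - a ord0 i) + sqnorm (y - a) * y ord0 i)); last first.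
  by apply/funext => y; rewrite /grad_cosh !mxE.
have h := is_deriveZ (1 - sqnorm a)^-1 (is_deriveD (is_derive_mul dS dc)
  (is_derive_mul dD (is_derive_coord i (@is_derive_id _ _ x e)))).
apply: (is_derive_eq h); rewrite /GRing.scale/= !dot_delta !mxE !eqxx/=; ring.
Qed.

Lemma is_derive_conf_exp m x i : hyp_space x ->
  is_derive x (delta_mx ord0 i : 'rV[R]_n) (fun y => conf y ^+ m)
    (conf x ^+ m * (m%:R * (2 * x ord0 i / (1 - sqnorm x)))).
Proof.
move=> /hyp_spaceP x1.
pose e : 'rV[R]_n := delta_mx ord0 i.
have dS := is_derive_sqnorm (@is_derive_id _ _ x e).
have h := is_deriveX m (is_deriveZ (2 : R) (is_derive_inv dS (lt0r_neq0 x1))).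
rewrite (_ : (fun y => _) = ((2 : R) *: (fun y : 'rV[R]_n => (1 - sqnorm y)^-1)) ^+ m); last first.
  by apply/funext => y; rewrite fctE.
apply: (is_derive_eq h); rewrite /GRing.scale/= dot_delta /=.
case: m => [|m] in h *; first by rewrite !(mulr0n, mul0r, mulr0).
rewrite [m.+1.-1]/= /conf (exprS (2 / _) m) [_ *: _]/(_ * _).
move: (m.+1%:R : R) => M; move: ((2 / (1 - sqnorm x)) ^+ m) => C.
field; lra.
Qed.

(** The Laplacian of [cosh r] is [n cosh r].  The left side is the divergence of the
    Euclidean field [conf ^+ n *: grad_cosh a], divided by the volume density
    [conf ^+ n]. *)
Lemma laplace_cosh a x : hyp_space a -> hyp_space x ->
  \sum_(i < n) ((n%:R * (2 * x ord0 i / (1 - sqnorm x))) * grad_cosh a x ord0 i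
    + (1 - sqnorm x + sqnorm (x - a)) / (1 - sqnorm a)) = n%:R * hyp_cosh a x.
Proof.
move=> /hyp_spaceP a1 /hyp_spaceP x1.
rewrite big_split/= sumr_const card_ord -[_ *+ n]mulr_natl.
rewrite (_ : \sum_(i < n) _ = n%:R * (2 / (1 - sqnorm x)) * dot x (grad_cosh a x)).
  rewrite /hyp_cosh /grad_cosh dotZr (dotC x) dot_comb dotBl.
  rewrite dotxx sqnormB (dotC a x).
  field; lra.
by rewrite /dot mulr_sumr; apply: eq_bigr => i _; ring.
Qed.

Lemma riem_inner_hyp x v : riem_inner (@hyp_metric R n) x v v = conf x ^+ 2 * sqnorm v.
Proof.
rewrite /riem_inner /hyp_metric mul_mx_scalar -scalemxAl mxE /conf exprMn exprVn.
rewrite (_ : 4 = 2 ^+ 2); last by ring.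
congr (_ * _); rewrite mxE; apply: eq_bigr => i _.
by rewrite mxE expr2.
Qed.

Lemma conf_gt0 x : hyp_space x -> 0 < conf x.
Proof. by move/hyp_spaceP => x1; rewrite divr_gt0. Qed.

Lemma hyp_grad_normE u x : hyp_space x ->
  hyp_grad_norm u x = Num.sqrt (sqnorm (partials u x)) / conf x.
Proof.
move=> xU; have c0 := conf_gt0 xU.
rewrite /hyp_grad_norm /riem_norm riem_inner_hyp /riem_grad /hyp_metric.
rewrite invmx_scalar mul_mx_scalar sqnormZ.
rewrite (_ : 4 / _ = conf x ^+ 2); last by rewrite /conf exprMn exprVn; congr (_ / _); ring.
rewrite (_ : _ * _ = sqnorm (partials u x) / conf x ^+ 2); last by field; exact: lt0r_neq0.
by rewrite sqrtrM ?sqnorm_ge0// sqrtrV ?sqr_ge0// sqrtr_sqr gtr0_norm.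
Qed.

Lemma sqrt_det_hyp_metric x : hyp_space x ->
  Num.sqrt (\det (hyp_metric x)) = conf x ^+ n.
Proof.
move=> xU; have c0 := conf_gt0 xU.
rewrite /hyp_metric det_scalar (_ : 4 / _ = conf x ^+ 2); last first.
  by rewrite /conf exprMn exprVn; congr (_ / _); ring.
by rewrite exprAC sqrtr_sqr ger0_norm// exprn_ge0// ltW.
Qed.

End poincare_ball.

(** * Hyperbolic functions, and continuity of the geometric quantities *)

Section hyperbolic_functions_theory.
Context (R : realType).
Implicit Types q t : R.

Definition acosh q : R := ln (q + Num.sqrt (q ^+ 2 - 1)).

Lemma cosh2_sinh2 t : cosh t ^+ 2 - sinh t ^+ 2 = 1.
Proof.
by rewrite -(expRxMexpNx_1 t) /cosh /sinh; field.
Qed.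

Lemma is_derive_cosh t : is_derive t 1 (@cosh R) (sinh t).
Proof.
have h1 := is_derive_expR t.
have h2 : is_derive t 1 (fun t : R => expR (- t)) (- expR (- t)).
  apply: (is_derive_eq (is_derive1_comp (is_derive_expR (- t)) (is_deriveNid t 1))).
  by rewrite mulrN1.
have h := is_deriveZ (2^-1 : R) (is_deriveD h1 h2).
rewrite (_ : @cosh R = 2^-1 *: (expR + (fun t => expR (- t)))); last first.
  by apply/funext => s; rewrite /cosh mulrC.
by apply: (is_derive_eq h); rewrite /sinh /GRing.scale/= mulrC.
Qed.

Lemma is_derive_sinh t : is_derive t 1 (@sinh R) (cosh t).
Proof.
have h1 := is_derive_expR t.
have h2 : is_derive t 1 (fun t : R => expR (- t)) (- expR (- t)).
  apply: (is_derive_eq (is_derive1_comp (is_derive_expR (- t)) (is_deriveNid t 1))).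
  by rewrite mulrN1.
have h := is_deriveZ (2^-1 : R) (is_deriveB h1 h2).
rewrite (_ : @sinh R = 2^-1 *: (expR - (fun t => expR (- t)))); last first.
  by apply/funext => s; rewrite /sinh mulrC.
by apply: (is_derive_eq h); rewrite /cosh /GRing.scale/= mulrC opprK.
Qed.

Section acosh.
Variable q : R.
Hypothesis q1 : 1 <= q.
Let S := Num.sqrt (q ^+ 2 - 1).

Let S2 : S ^+ 2 = q ^+ 2 - 1.
Proof. by rewrite sqr_sqrtr// subr_ge0 expr_ge1// (le_trans ler01). Qed.

Let S0 : 0 <= S. Proof. exact: sqrtr_ge0. Qed.

Let qS : 0 < q + S. Proof. by rewrite ltr_pwDl// (lt_le_trans ltr01). Qed.

Let expR_acosh : expR (acosh q) = q + S.
Proof. by rewrite lnK// posrE. Qed.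

Let expRN_acosh : expR (- acosh q) = q - S.
Proof.
rewrite expRN expR_acosh; apply: (mulfI (lt0r_neq0 qS)).
by rewrite mulfV ?lt0r_neq0// mulrC -subr_sqr S2; ring.
Qed.

Lemma acoshK : cosh (acosh q) = q.
Proof. by rewrite /cosh expR_acosh expRN_acosh; field. Qed.

Lemma sinh_acosh : sinh (acosh q) = Num.sqrt (q ^+ 2 - 1).
Proof. by rewrite /sinh expR_acosh expRN_acosh -/S; field. Qed.
End acosh.

Lemma acosh1 : acosh 1 = 0.
Proof. by rewrite /acosh expr1n subrr sqrtr0 addr0 ln1. Qed.

Lemma acosh_gt0 q : 1 < q -> 0 < acosh q.
Proof. by move=> q1; rewrite ln_gt0// (lt_le_trans q1)// lerDl sqrtr_ge0. Qed.

Lemma sqrt_sqr_sub1_gt0 q : 1 < q -> 0 < Num.sqrt (q ^+ 2 - 1).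
Proof. by move=> q1; rewrite sqrtr_gt0 subr_gt0 expr_gt1// (ltW (lt_trans ltr01 _)). Qed.

End hyperbolic_functions_theory.

Section continuity.
Context (R : realType) (n : nat).
Implicit Types (x y a : 'rV[R]_n).

Lemma cvg_dot (T : Type) (F : set_system T) {FF : Filter F}
    (f g : T -> 'rV[R]_n) x y :
  f @ F --> x -> g @ F --> y -> dot (f t) (g t) @[t --> F] --> dot x y.
Proof.
move=> fx gy; rewrite /dot.
apply: cvg_big => [|i _]; first exact: add_continuous.
have c z : {for z, continuous (fun z : 'rV[R]_n => z ord0 i)}.
  exact: coord_continuous.
by apply: cvgM; [exact: (continuous_cvg _ (c x))|exact: (continuous_cvg _ (c y))].
Qed.

Section cvg.
Context (T : Type) (F : set_system T) {FF : Filter F}.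
Variables (c : T -> 'rV[R]_n) (x : 'rV[R]_n).
Hypothesis cx : c @ F --> x.

Lemma cvg_sqnorm : sqnorm (c t) @[t --> F] --> sqnorm x.
Proof.
by rewrite -dotxx; under eq_cvg do rewrite -dotxx; exact: cvg_dot.
Qed.

Lemma cvg_conf : hyp_space x -> conf (c t) @[t --> F] --> conf x.
Proof.
move=> /hyp_spaceP x1; apply: cvgM; first exact: cvg_cst.
apply: cvgV; first by rewrite lt0r_neq0.
by apply: cvgB; [exact: cvg_cst|exact: cvg_sqnorm].
Qed.
End cvg.

Section cvg_cosh.
Context (T : Type) (F : set_system T) {FF : Filter F}.
Variables (c : T -> 'rV[R]_n) (x a : 'rV[R]_n).
Hypothesis cx : c @ F --> x.

Lemma cvg_sqnormB : sqnorm (c t - a) @[t --> F] --> sqnorm (x - a).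
Proof. by apply: cvg_sqnorm; apply: cvgB => //; exact: cvg_cst. Qed.

Lemma cvg_hyp_cosh : hyp_space a -> hyp_space x ->
  hyp_cosh a (c t) @[t --> F] --> hyp_cosh a x.
Proof.
move=> /hyp_spaceP a1 /hyp_spaceP x1; rewrite /hyp_cosh.
apply: cvgD; first exact: cvg_cst.
apply: cvgM; first by apply: cvgM; [exact: cvg_cst|exact: cvg_sqnormB].
apply: cvgV; first by rewrite lt0r_neq0// mulr_gt0.
apply: cvgM; last exact: cvg_cst.
by apply: cvgB; [exact: cvg_cst|exact: cvg_sqnorm].
Qed.

Lemma cvg_grad_cosh : grad_cosh a (c t) @[t --> F] --> grad_cosh a x.
Proof.
rewrite /grad_cosh; apply: cvgZl_tmp; apply: cvgD.
  apply: cvgZ; first by apply: cvgB; [exact: cvg_cst|exact: cvg_sqnorm].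
  by apply: cvgB => //; exact: cvg_cst.
by apply: cvgZ => //; exact: cvg_sqnormB.
Qed.
End cvg_cosh.

Lemma open_hyp_space : open (@hyp_space R n).
Proof.
rewrite (_ : @hyp_space R n = @sqnorm R n @^-1` `]-oo, 1[%classic).
  apply: open_comp; last exact: interval_open.
  by move=> x _; apply: (@cvg_sqnorm _ (nbhs x) _ id x); exact: cvg_id.
by apply/seteqP; split => x /=; rewrite /hyp_space /= in_itv.
Qed.

End continuity.

(** * Lower bound for the length of curves *)

Section distance_lower_bound.
Context (R : realType) (n : nat).
Implicit Types (x y a w : 'rV[R]_n).

Lemma riem_normE x w : hyp_space x ->
  riem_norm (@hyp_metric R n) x w = conf x * Num.sqrt (sqnorm w).
Proof.
move=> xU; rewrite /riem_norm riem_inner_hyp sqrtrM ?sqr_ge0//.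
by rewrite sqrtr_sqr gtr0_norm// conf_gt0.
Qed.

(** The Cauchy-Schwarz inequality for the metric, with the gradient of [cosh r] on
    one side; its norm is [sinh r]. *)
Lemma hyp_cosh_lip a x w : hyp_space a -> hyp_space x ->
  `|conf x ^+ 2 * dot (grad_cosh a x) w| <=
  Num.sqrt (hyp_cosh a x ^+ 2 - 1) * riem_norm (@hyp_metric R n) x w.
Proof.
move=> aU xU; rewrite riem_normE//.
have c0 := conf_gt0 xU.
have q1 : 0 <= hyp_cosh a x ^+ 2 - 1.
  by rewrite subr_ge0 expr_ge1 ?hyp_cosh_ge1// (le_trans ler01)// hyp_cosh_ge1.
rewrite -conf_grad_cosh// in q1 *.
move: (conf x) (grad_cosh a x) c0 q1 => C v c0 q1.
suff : `|C ^+ 2 * dot v w| ^+ 2 <=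
    (Num.sqrt (C ^+ 2 * sqnorm v) * (C * Num.sqrt (sqnorm w))) ^+ 2.
  rewrite ler_pXn2r// ?nnegrE//; apply: mulr_ge0; first exact: sqrtr_ge0.
  by apply: mulr_ge0; [exact: ltW|exact: sqrtr_ge0].
rewrite real_normK ?num_real// !exprMn !sqr_sqrtr ?sqnorm_ge0//.
have := ler_wpM2l (sqr_ge0 (C ^+ 2)) (cauchy_schwarz v w).
by move=> /le_trans; apply; rewrite le_eqVlt; apply/orP; left; apply/eqP; ring.
Qed.

(** [acosh] has infinite slope at [1], hence is not differentiable along a curve that
    meets its end point.  The shift by [e > 0] makes it smooth there, and the error
    vanishes with [e]. *)
Definition acosh_reg (e q : R) : R := ln (q + Num.sqrt (q ^+ 2 - 1 + e)).

Lemma is_derive_acosh_reg (e q : R) : 0 < q -> 0 < q ^+ 2 - 1 + e ->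
  is_derive q 1 (acosh_reg e) (Num.sqrt (q ^+ 2 - 1 + e))^-1.
Proof.
move=> q0; set s := q ^+ 2 - 1 + e => s0.
have S0 : 0 < Num.sqrt s by rewrite sqrtr_gt0.
have qS : 0 < q + Num.sqrt s by rewrite addr_gt0.
have ds : is_derive q 1 (fun q : R => q ^+ 2 - 1 + e) (2 * q).
  have h := is_deriveD (is_deriveB (is_deriveX 2 (@is_derive_id R _ q 1))
    (is_derive_cst (1 : R) q 1)) (is_derive_cst e q 1).
  by apply: (is_derive_eq h); rewrite /GRing.scale/= expr1 mulr1; ring.
have dS := @is_derive1_comp _ Num.sqrt (fun q : R => q ^+ 2 - 1 + e) q _ _
  (is_derive1_sqrt s0) ds.
have h := @is_derive1_comp _ (@ln R) (fun q : R => q + Num.sqrt (q ^+ 2 - 1 + e)) q _ _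
  (is_derive1_ln qS) (is_deriveD (@is_derive_id R _ q 1) dS).
apply: (is_derive_eq h).
field; lra.
Qed.

Lemma is_derive_acosh (q : R) : 1 < q ->
  is_derive q 1 (@acosh R) (Num.sqrt (q ^+ 2 - 1))^-1.
Proof.
move=> q1; have q0 : 0 < q by exact: lt_trans q1.
rewrite (_ : @acosh R = acosh_reg 0); last first.
  by apply/funext => z; rewrite /acosh_reg addr0.
rewrite -[X in Num.sqrt X]addr0; apply: is_derive_acosh_reg => //.
by rewrite addr0 subr_gt0 expr_gt1// ltW.
Qed.

Lemma acosh_le_reg (e q : R) : 0 <= e -> 1 <= q -> acosh q <= acosh_reg e q.
Proof.
move=> e0 q1; have q0 : 0 < q by exact: lt_le_trans q1.
have s0 : 0 <= q ^+ 2 - 1 by rewrite subr_ge0 expr_ge1// ltW.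
rewrite ler_ln ?posrE ?ltr_pwDl ?sqrtr_ge0//.
by rewrite lerD2l ler_wsqrtr// lerDl.
Qed.

Lemma acosh_reg1 (e : R) : 0 <= e -> acosh_reg e 1 <= Num.sqrt e.
Proof.
move=> e0; rewrite /acosh_reg expr1n subrr add0r le_ln1Dx//.
by rewrite (lt_le_trans _ (sqrtr_ge0 e))// ltrN10.
Qed.

Section path.
Variables (x a : 'rV[R]_n) (c : R -> 'rV[R]_n).
Hypothesis aU : hyp_space a.
Hypothesis cP : C1_path (@hyp_space R n) x a c.

Let cU (t : R) : 0 <= t <= 1 -> hyp_space (c t).
Proof. by case: cP => _ _ _ _; exact. Qed.

Let dc (t : R) : is_derive t 1 c (derive1 c t).
Proof. by case: cP => hc _ _ _ _; rewrite derive1E; exact: derivableP. Qed.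

Let cc (t : R) : c s @[s --> t] --> c t.
Proof.
apply: differentiable_continuous; apply/derivable1_diffP.
exact: ex_derive.
Qed.

Let cc' (t : R) : derive1 c s @[s --> t] --> derive1 c t.
Proof. by case: cP => _ + _ _ _; exact. Qed.

Let speed (t : R) := riem_norm (@hyp_metric R n) (c t) (derive1 c t).

Let speed_cont : {within `[0, 1], continuous speed}.
Proof.
pose g (t : R) := conf (c t) * Num.sqrt (sqnorm (derive1 c t)).
have : {within `[0, 1], continuous g}.
  apply/subspace_continuousP => t /=; rewrite in_itv/= => t01.
  apply: cvg_within_filter; apply: cvgM.
    by apply: cvg_conf; [exact: cc|exact: cU].
  apply: (continuous_cvg _ (@sqrt_continuous R _)).
  by apply: cvg_sqnorm; exact: cc'.
apply: subspace_eq_continuous => t; rewrite inE/= in_itv/= => t01.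
by rewrite /g /from_subspace/= -riem_normE//; exact: cU.
Qed.

(** Along a curve, [acosh (cosh r)] grows at most at unit speed, because
    [|grad cosh r| = sinh r]; it is [0] at the end point. *)
Lemma acosh_le_length : acosh (hyp_cosh a x) <= riem_length (@hyp_metric R n) c.
Proof.
have [_ _ c0 c1 _] := cP.
have xU : hyp_space x by rewrite -c0; apply: cU; rewrite lexx ler01.
have q1 (t : R) : 0 <= t <= 1 -> 1 <= hyp_cosh a (c t).
  by move=> t01; apply: hyp_cosh_ge1 => //; exact: cU.
have ispeed : (@lebesgue_measure R).-integrable `[0, 1] (EFin \o speed).
  by apply: continuous_compact_integrable => //; exact: segment_compact.
suff bound e : 0 < e -> acosh (hyp_cosh a x) <=
    riem_length (@hyp_metric R n) c + Num.sqrt e.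
  apply/ler_addgt0Pr => e e0; have := bound (e ^+ 2) (exprn_gt0 _ e0).
  by rewrite sqrtr_sqr gtr0_norm.
move=> e0.
pose g (t : R) := acosh_reg e (hyp_cosh a (c t)).
pose S (t : R) := Num.sqrt (hyp_cosh a (c t) ^+ 2 - 1 + e).
pose g' (t : R) := (S t)^-1 * (conf (c t) ^+ 2 * dot (grad_cosh a (c t)) (derive1 c t)).
have S_gt0 (t : R) : 0 <= t <= 1 -> 0 < S t.
  move=> t01; rewrite sqrtr_gt0 ltr_wpDl// subr_ge0 expr_ge1 ?q1//.
  by rewrite (le_trans ler01)// q1.
have dg (t : R) : 0 <= t <= 1 -> is_derive t 1 g (g' t).
  move=> t01; apply: (@is_derive1_comp _ (acosh_reg e) (fun t => hyp_cosh a (c t))).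
    apply: is_derive_acosh_reg; first by rewrite (lt_le_trans ltr01)// q1.
    by rewrite -sqrtr_gt0 S_gt0.
  by apply: is_derive_hyp_cosh => //; exact: cU.
have cg (t : R) : 0 <= t <= 1 -> g s @[s --> t] --> g t.
  move=> t01; apply: differentiable_continuous; apply/derivable1_diffP.
  by have [] := dg t t01.
have cg' : {within `[0, 1], continuous g'}.
  apply/subspace_continuousP => t /=; rewrite in_itv/= => t01.
  apply: cvg_within_filter; apply: cvgM.
    apply: cvgV; first by rewrite lt0r_neq0// S_gt0.
    apply: (continuous_cvg _ (@sqrt_continuous R _)).
    apply: cvgD; last exact: cvg_cst.
    apply: cvgB; last exact: cvg_cst.
    have h : hyp_cosh a (c s) @[s --> t] --> hyp_cosh a (c t).
      by apply: cvg_hyp_cosh => //; [exact: cc|exact: cU].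
    by apply: cvgM; exact: h.
  have h : conf (c s) @[s --> t] --> conf (c t).
    by apply: cvg_conf; [exact: cc|exact: cU].
  apply: cvgM; first by apply: cvgM; exact: h.
  by apply: cvg_dot; [apply: cvg_grad_cosh; exact: cc|exact: cc'].
have ig' : (@lebesgue_measure R).-integrable `[0, 1] (EFin \o g').
  by apply: continuous_compact_integrable => //; exact: segment_compact.
have FTC : (\int[@lebesgue_measure R]_(t in `[0, 1]) g' t = g 1 - g 0)%R.
  rewrite /Rintegral (@continuous_FTC2 _ g' g)//.
    split=> [t||].
    - by rewrite in_itv/= => /andP[t0 t1]; have [] := dg t; rewrite ?ltW.
    - by apply: cvg_at_right_filter; apply: cg; rewrite lexx ler01.
    - by apply: cvg_at_left_filter; apply: cg; rewrite lexx ler01.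
  move=> t; rewrite in_itv/= => /andP[t0 t1]; rewrite derive1E.
  by have [] := dg t; rewrite ?ltW.
have le_g' : (`|\int[@lebesgue_measure R]_(t in `[0, 1]) g' t| <=
    \int[@lebesgue_measure R]_(t in `[0, 1]) speed t)%R.
  apply: (le_trans (le_normr_Rintegral _ ig')) => //.
  apply: le_Rintegral => //; first exact: integrable_norm.
  move=> t; rewrite /= in_itv/= => t01.
  rewrite /g' normrM gtr0_norm ?invr_gt0 ?S_gt0//.
  rewrite ler_pdivrMl ?S_gt0//; apply: (le_trans (hyp_cosh_lip _ aU (cU t01))).
  rewrite ler_wpM2r//; first by rewrite sqrtr_ge0.
  by rewrite ler_wsqrtr// lerDl ltW.
have -> : riem_length (@hyp_metric R n) c =
    (\int[@lebesgue_measure R]_(t in `[0, 1]) speed t)%R by [].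
move: le_g'; rewrite FTC /g c0 c1 distrC => /(le_trans (ler_norm _)).
have -> : hyp_cosh a a = 1 by apply/eqP; rewrite hyp_cosh_eq1.
have h1 := acosh_reg1 (ltW e0).
have h2 := acosh_le_reg (ltW e0) (hyp_cosh_ge1 aU xU).
lra.
Qed.
End path.
End distance_lower_bound.

(** * Geodesics and the distance formula *)

Section geodesic.
Context (R : realType) (n : nat).
Implicit Types (x y a w : 'rV[R]_n).

(** In the hyperboloid model, with the Lorentz form [- x0 y0 + dot x y], a geodesic of
    speed [d] is [s |-> cosh (s d) (p0, p) + sinh (s d) (t0, tt)], where [(p0, p)] lies on
    the hyperboloid and [(t0, tt)] is a unit tangent vector at it: these are the
    hypotheses on [p] and [tt].  The stereographic projection
    [(y0, y) |-> y / (1 + y0)] sends it to [hyp_line] in the ball.  Below, [X0] is the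
    time coordinate of the geodesic and [Y0] is [X0' / d]. *)
Section hyperboloid.
Variables (d p0 t0 : R) (p tt : 'rV[R]_n).
Hypotheses (p0_ge1 : 1 <= p0) (pp : sqnorm p = p0 ^+ 2 - 1)
  (ptt : dot p tt = p0 * t0) (ttt : sqnorm tt = 1 + t0 ^+ 2).

Let ch (s : R) := cosh (s * d).
Let sh (s : R) := sinh (s * d).
Let X0 (s : R) := ch s * p0 + sh s * t0.
Let Y0 (s : R) := sh s * p0 + ch s * t0.
Let D (s : R) := 1 + X0 s.

Let dch (s : R) : is_derive s 1 ch (d * sh s).
Proof.
have h := @is_derive1_comp _ (@cosh R) (fun s : R => s * d) s _ _
  (is_derive_cosh (s * d)) (is_derive_mul (@is_derive_id R _ s 1) (is_derive_cst d s 1)).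
by apply: (is_derive_eq h); rewrite mulr0 addr0 mul1r mulrC.
Qed.

Let dsh (s : R) : is_derive s 1 sh (d * ch s).
Proof.
have h := @is_derive1_comp _ (@sinh R) (fun s : R => s * d) s _ _
  (is_derive_sinh (s * d)) (is_derive_mul (@is_derive_id R _ s 1) (is_derive_cst d s 1)).
by apply: (is_derive_eq h); rewrite mulr0 addr0 mul1r mulrC.
Qed.

Let chsh (s : R) : ch s ^+ 2 = 1 + sh s ^+ 2.
Proof. by apply/eqP; rewrite -subr_eq; apply/eqP; exact: cosh2_sinh2. Qed.

Let t0_lt : `|t0| < p0.
Proof.
have p00 : 0 < p0 by exact: lt_le_trans p0_ge1.
have := cauchy_schwarz p tt; rewrite ptt pp ttt => cs.
suff : `|t0| ^+ 2 < p0 ^+ 2 by rewrite ltr_pXn2r// ?nnegrE ?normr_ge0// ltW.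
rewrite real_normK ?num_real//.
by move: cs; rewrite exprMn => cs; lra.
Qed.

Let X0_gt0 s : 0 < X0 s.
Proof.
have := t0_lt; rewrite ltr_norml => /andP[t1 t2].
rewrite (_ : X0 s = expR (s * d) * ((p0 + t0) / 2) +
    expR (- (s * d)) * ((p0 - t0) / 2)); last first.
  by rewrite /X0 /ch /sh /cosh /sinh; field.
by rewrite addr_gt0// mulr_gt0 ?expR_gt0//; lra.
Qed.

Let D_gt0 s : 0 < D s. Proof. by rewrite addr_gt0// X0_gt0. Qed.

Definition hyp_line (s : R) : 'rV[R]_n := (ch s / D s) *: p + (sh s / D s) *: tt.

Let alpha s := d * (sh s * D s - ch s * Y0 s) / D s ^+ 2.
Let beta s := d * (ch s * D s - sh s * Y0 s) / D s ^+ 2.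

Let dD (s : R) : is_derive s 1 D (d * Y0 s).
Proof.
have h := is_deriveD (is_derive_cst (1 : R) s 1) (is_deriveD
  (is_derive_mul (dch s) (is_derive_cst p0 s 1))
  (is_derive_mul (dsh s) (is_derive_cst t0 s 1))).
by apply: (is_derive_eq h); rewrite /Y0 /=; ring.
Qed.

Let dline (s : R) : is_derive s 1 hyp_line (alpha s *: p + beta s *: tt).
Proof.
have D0 := lt0r_neq0 (D_gt0 s).
apply: is_derive_row => i; rewrite !mxE.
have dI := is_derive_inv (dD s) D0.
have h := is_deriveD
  (is_derive_mul (is_derive_mul (dch s) dI) (is_derive_cst (p ord0 i) s 1))
  (is_derive_mul (is_derive_mul (dsh s) dI) (is_derive_cst (tt ord0 i) s 1)).
rewrite (_ : (fun y : R => hyp_line y ord0 i) =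
    fun s : R => ch s / D s * p ord0 i + sh s / D s * tt ord0 i); last first.
  by apply/funext => y; rewrite !mxE.
apply: (is_derive_eq h); rewrite /alpha /beta /=.
by field.
Qed.

Lemma derive1_hyp_line s : derive1 hyp_line s = alpha s *: p + beta s *: tt.
Proof. by rewrite derive1E; have [_ ->] := dline s. Qed.

Lemma derivable_hyp_line s : derivable hyp_line s 1.
Proof. by have [] := dline s. Qed.

Lemma derive1_hyp_line_continuous : continuous (derive1 hyp_line).
Proof.
have -> : derive1 hyp_line = fun s => alpha s *: p + beta s *: tt.
  by apply/funext => s; exact: derive1_hyp_line.
move=> s.
have c1 := is_derive_cvg (dch s).
have c2 := is_derive_cvg (dsh s).
have c3 := is_derive_cvg (dD s).
have c4 : Y0 t @[t --> s] --> Y0 s.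
  by apply: cvgD; apply: cvgM => //; exact: cvg_cst.
have c5 : (D t ^+ 2)^-1 @[t --> s] --> (D s ^+ 2)^-1.
  apply: cvgV; first by rewrite expf_neq0// lt0r_neq0.
  by apply: cvgM; exact: c3.
apply: cvgD; apply: cvgZr_tmp; apply: cvgM => //; apply: cvgM; try exact: cvg_cst;
  by apply: cvgB; apply: cvgM.
Qed.

Let sqnorm_line s : 1 - sqnorm (hyp_line s) = 2 / D s.
Proof.
have D0 := lt0r_neq0 (D_gt0 s).
rewrite /hyp_line sqnorm_comb pp ptt ttt.
have -> : (ch s / D s) ^+ 2 * (p0 ^+ 2 - 1) + 2 * (ch s / D s) * (sh s / D s) * (p0 * t0) +
    (sh s / D s) ^+ 2 * (1 + t0 ^+ 2) = (X0 s ^+ 2 - (ch s ^+ 2 - sh s ^+ 2)) / D s ^+ 2.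
  by rewrite /X0; field.
rewrite chsh (_ : X0 s = D s - 1); last by rewrite /D; ring.
by field.
Qed.

Lemma hyp_line_ball s : hyp_space (hyp_line s).
Proof.
have := D_gt0 s; have := sqnorm_line s => E D0.
by rewrite /hyp_space/= -subr_gt0 E divr_gt0.
Qed.

Lemma hyp_line_speed s : 0 <= d ->
  riem_norm (@hyp_metric R n) (hyp_line s) (derive1 hyp_line s) = d.
Proof.
move=> d0; have D0 := lt0r_neq0 (D_gt0 s).
rewrite riem_normE; last exact: hyp_line_ball.
rewrite derive1_hyp_line sqnorm_comb pp ptt ttt /conf sqnorm_line.
set Z := (X in Num.sqrt X).
have -> : Z = (d / D s) ^+ 2.
  rewrite /Z /alpha /beta.
  have -> : forall u v, (d * u / D s ^+ 2) ^+ 2 * (p0 ^+ 2 - 1) +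
      2 * (d * u / D s ^+ 2) * (d * v / D s ^+ 2) * (p0 * t0) +
      (d * v / D s ^+ 2) ^+ 2 * (1 + t0 ^+ 2) =
      d ^+ 2 * ((u * p0 + v * t0) ^+ 2 + v ^+ 2 - u ^+ 2) / D s ^+ 4.
    by move=> u v; field.
  have -> : (sh s * D s - ch s * Y0 s) * p0 + (ch s * D s - sh s * Y0 s) * t0 = Y0 s.
    rewrite /D /X0 /Y0; ring.
  have -> : Y0 s ^+ 2 + (ch s * D s - sh s * Y0 s) ^+ 2 - (sh s * D s - ch s * Y0 s) ^+ 2
     = D s ^+ 2 + (ch s ^+ 2 - sh s ^+ 2 - 1) * (D s ^+ 2 - Y0 s ^+ 2) by ring.
  rewrite chsh; by field.
rewrite sqrtr_sqr ger0_norm; last by rewrite divr_ge0// ltW.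
by field.
Qed.

End hyperboloid.

(** The lower bound for lengths is attained by the arc of [hyp_line] from [x] to [a]. *)
Theorem hyp_distE a x : hyp_space a -> hyp_space x ->
  hyp_dist x a = acosh (hyp_cosh a x).
Proof.
move=> aU xU.
pose L := [set riem_length (@hyp_metric R n) c | c in [set c | C1_path (@hyp_space R n) x a c]].
suff LQ : L (acosh (hyp_cosh a x)).
  apply/eqP; rewrite eq_le; apply/andP; split.
    apply: ge_inf => //; exists (acosh (hyp_cosh a x)) => _ [c cP <-].
    exact: acosh_le_length.
  apply: lb_le_inf; first by exists (acosh (hyp_cosh a x)).
  by move=> _ [c cP <-]; exact: acosh_le_length.
have [xa|xa] := eqVneq x a.
  exists (cst a).
    split=> //; rewrite ?xa//.
    - rewrite (_ : derive1 _ = cst 0); first exact: cst_continuous.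
      by apply/funext => t; rewrite derive1_cst.
  rewrite xa.
  have -> : hyp_cosh a a = 1 by apply/eqP; rewrite hyp_cosh_eq1.
  rewrite acosh1 /riem_length -[RHS](mul0r (fine (@lebesgue_measure R `[0, 1]%classic))).
  rewrite -Rintegral_cst//; apply: eq_Rintegral => t _ /=.
  rewrite derive1_cst riem_normE// (_ : sqnorm 0 = 0) ?sqrtr0 ?mulr0//.
  by apply/eqP; rewrite sqnorm_eq0.
have Q1 : 1 < hyp_cosh a x.
  by rewrite lt_def hyp_cosh_eq1// xa hyp_cosh_ge1.
have S0 := sqrt_sqr_sub1_gt0 Q1.
have S2 : Num.sqrt (hyp_cosh a x ^+ 2 - 1) ^+ 2 = hyp_cosh a x ^+ 2 - 1.
  by rewrite sqr_sqrtr// subr_ge0 expr_ge1 ?(ltW Q1)// ltW// (lt_trans ltr01).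
pose d := acosh (hyp_cosh a x).
have dch : cosh d = hyp_cosh a x by rewrite acoshK// ltW.
have dsh : sinh d = Num.sqrt (hyp_cosh a x ^+ 2 - 1) by rewrite sinh_acosh// ltW.
have d0 : 0 < d by exact: acosh_gt0.
move: dch dsh S0 S2.
set Q := hyp_cosh a x; set S := Num.sqrt _ => dch dsh S0 S2.
have a1 := hyp_spaceP aU; have x1 := hyp_spaceP xU.
(* [(p0, p)] and [(b0, b)] are the points of the hyperboloid over [x] and [a], whose
   Lorentz product is [- Q]; [(t0, tt)] is the normalized component of the second
   one orthogonal to the first, so that [(b0, b)] is the geodesic at time [1]. *)
pose p0 := (1 + sqnorm x) / (1 - sqnorm x).
pose p := (2 / (1 - sqnorm x)) *: x.
pose b0 := (1 + sqnorm a) / (1 - sqnorm a).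
pose b := (2 / (1 - sqnorm a)) *: a.
pose t0 := (b0 - Q * p0) / S.
pose tt := S^-1 *: (b - Q *: p).
have p0_ge1 : 1 <= p0.
  by rewrite ler_pdivlMr// mul1r; have := sqnorm_ge0 x; lra.
have pp : sqnorm p = p0 ^+ 2 - 1 by rewrite sqnormZ /p0; field; lra.
have bb : sqnorm b = b0 ^+ 2 - 1 by rewrite sqnormZ /b0; field; lra.
have pb : dot p b = p0 * b0 - Q.
  by rewrite dotZl dotZr /Q /hyp_cosh /p0 /b0 sqnormB; field; lra.
have SN0 := lt0r_neq0 S0.
have ttE : tt = S^-1 *: b + (- (Q / S)) *: p.
  by rewrite /tt scalerDr; congr (_ + _); rewrite -scaleNr scalerA mulrC mulNr.
have ptt : dot p tt = p0 * t0.
  by rewrite ttE dotC dot_comb dotxx (dotC b) pb pp /t0; field.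
have ttt : sqnorm tt = 1 + t0 ^+ 2.
  rewrite ttE sqnorm_comb (dotC b) pb pp bb /t0.
  rewrite -[X in _ = X + _](divff (expf_neq0 2 SN0)) [X in _ = X / _ + _]S2.
  by field.
have D0 : 1 + b0 = 2 / (1 - sqnorm a) by rewrite /b0; field; lra.
have D1 : 1 + p0 = 2 / (1 - sqnorm x) by rewrite /p0; field; lra.
exists (hyp_line d p0 t0 p tt).
  split.
  - by move=> t; apply: derivable_hyp_line.
  - exact: derive1_hyp_line_continuous.
  - rewrite /hyp_line !mul0r /cosh /sinh oppr0 expR0 subrr !mul0r scale0r addr0.
    rewrite (_ : (1 + 1) / 2 = 1 :> R); last by field.
    by rewrite !mul1r !addr0 D1 /p scalerA mulVf ?scale1r// mulf_neq0 ?invr_eq0 ?lt0r_neq0.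
  - rewrite /hyp_line !mul1r dch dsh.
    have -> : 1 + (Q * p0 + S * t0) = 1 + b0 by rewrite /t0; field.
    have lin (u v : 'rV[R]_n) : (Q / (1 + b0)) *: u +
        (S / (1 + b0)) *: (S^-1 *: v + - (Q / S) *: u) = (1 + b0)^-1 *: v.
      rewrite scalerDr addrCA !scalerA -scalerDl.
      rewrite (_ : Q / _ + _ = 0) ?scale0r ?addr0; last first.
        by rewrite D0; field; rewrite SN0/=; lra.
      by congr (_ *: _); rewrite D0; field; rewrite SN0/=; lra.
    rewrite ttE lin /b scalerA D0 mulVf ?scale1r//.
    by rewrite mulf_neq0 ?invr_eq0 ?lt0r_neq0.
  - by move=> t _; exact: hyp_line_ball.
rewrite /riem_length.
transitivity (\int[@lebesgue_measure R]_(t in `[0%R, 1%R]) d)%R.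
  apply: eq_Rintegral => t _.
  by apply: hyp_line_speed => //; exact: ltW.
rewrite Rintegral_cst//.
by rewrite /= lebesgue_measure_itv/= lte_fin ltr01 oppr0 adde0 mulr1.
Qed.
End geodesic.

(** * Powers of absolute values *)

Section powers.
Context (R : realType).
Implicit Types p x y : R.

Lemma is_derive0_quadratic (f : R -> R) : f 0 = 0 ->
  (forall y, `|y| <= 1 -> `|f y| <= y ^+ 2) -> is_derive (0 : R) 1 f 0.
Proof.
move=> f0 fq.
suff h : (h^-1 *: (f (h *: (1 : R) + 0) - f 0)) @[h --> 0^'] --> (0 : R).
  by split; [apply/cvg_ex; exists 0|exact/cvg_lim].
apply/cvgrPdist_le => /= e e0.
near=> h; rewrite sub0r normrN addr0 f0 subr0 [_%:A]mulr1 normrM normfV.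
have h0 : 0 < `|h| by rewrite normr_gt0; near: h; exact: nbhs_dnbhs_neq.
rewrite ler_pdivrMl//; apply: (le_trans (fq h _)).
  by near: h; exact: dnbhs0_le.
rewrite -real_normK ?num_real// expr2 ler_wpM2l//.
by near: h; exact: dnbhs0_le.
Unshelve. all: by end_near. Qed.

Definition pospart y : R := Num.max y 0.

Lemma is_derive_sqr_pospart y :
  is_derive y 1 (fun y : R => pospart y ^+ 2) (2 * pospart y).
Proof.
have [y0|y0|->] := ltgtP y 0.
- apply: (@near_eq_is_derive _ _ _ (cst 0)); last first.
    by rewrite /pospart max_r ?mulr0 ?ltW//; exact: is_derive_cst.
  near=> z; rewrite /pospart max_r ?expr0n// ltW//; near: z; exact: lt_nbhsl.
- apply: (@near_eq_is_derive _ _ _ (fun z : R => z ^+ 2)); last first.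
    have h := is_deriveX 2 (@is_derive_id R _ y 1).
    apply: (is_derive_eq h).
    by rewrite /pospart max_l ?ltW// expr1 /GRing.scale/= mulr1 mulr_natl.
  near=> z; rewrite /pospart max_l// ltW//; near: z; exact: lt_nbhsr.
- rewrite /pospart maxxx mulr0; apply: is_derive0_quadratic.
    by rewrite maxxx expr0n.
  move=> z _; rewrite ger0_norm ?sqr_ge0//.
  by have [z0|z0] := leP z 0; rewrite ?expr0n ?sqr_ge0.
Unshelve. all: by end_near. Qed.

Definition abspow p y : R := `|y| `^ p.
Definition abspow' p y : R := p * y * `|y| `^ (p - 2).

Lemma abspow'_norm p y : 2 <= p -> `|abspow' p y| = p * `|y| `^ (p - 1).
Proof.
move=> p2; rewrite /abspow' !normrM (ger0_norm (powR_ge0 _ _)) ger0_norm; last by lra.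
by rewrite -mulrA -[in RHS](@mulr_powRB1 _ _ (p - 1))//; [congr (_ * (_ * _ `^ _)); ring|lra].
Qed.

Lemma is_derive_abspow p y : 2 <= p -> is_derive y 1 (abspow p) (abspow' p y).
Proof.
move=> p2.
have [y0|y0|->] := ltgtP y 0.
- have ny : 0 < - y by rewrite oppr_gt0.
  apply: (@near_eq_is_derive _ _ _ (fun z : R => (- z) `^ p)).
    near=> z; rewrite /abspow ltr0_norm//; near: z; exact: lt_nbhsl.
  have h : is_derive y 1 (fun z : R => (- z) `^ p) (p * (- y) `^ (p - 1) * - 1).
    exact: (@is_derive1_comp _ (fun z : R => z `^ p) (fun z : R => - z) y _ _
      (is_derive1_powR p ny) (is_deriveNid y 1)).
  apply: (is_derive_eq h).
  rewrite /abspow' ltr0_norm// -(@mulr_powRB1 _ _ (p - 1)) ?ltW//; last by lra.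
  rewrite (_ : p - 1 - 1 = p - 2); ring.
- apply: (@near_eq_is_derive _ _ _ (fun z : R => z `^ p)).
    near=> z; rewrite /abspow gtr0_norm//; near: z; exact: lt_nbhsr.
  apply: (is_derive_eq (is_derive1_powR p y0)).
  rewrite /abspow' gtr0_norm// -(@mulr_powRB1 _ _ (p - 1)) ?ltW//; last by lra.
  rewrite (_ : p - 1 - 1 = p - 2); ring.
- rewrite /abspow' mulr0 mul0r; apply: is_derive0_quadratic.
    by rewrite /abspow normr0 powR0//; apply/eqP; lra.
  move=> z z1; rewrite /abspow ger0_norm ?powR_ge0//.
  have [->|z0] := eqVneq z 0.
    by rewrite normr0 powR0 ?expr0n//; apply/eqP; lra.
  rewrite -real_normK ?num_real// -powR_mulrn//.
  by apply: ger_powR => //; rewrite normr_gt0 z0.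
Unshelve. all: by end_near. Qed.

Lemma abspow0 p : 2 <= p -> abspow p 0 = 0.
Proof. by move=> p2; rewrite /abspow normr0 powR0//; apply/eqP; lra. Qed.

Lemma abspow_continuous p : 2 <= p -> continuous (abspow p).
Proof. by move=> p2 y; exact: is_derive_cvg (is_derive_abspow y p2). Qed.

Lemma powR_gt0_continuous p y : 0 < y -> z `^ p @[z --> y] --> y `^ p.
Proof.
move=> y0; have [h _] := is_derive1_powR p y0.
by apply: (@differentiable_continuous _ _ _ y (fun z : R => z `^ p)); exact/derivable1_diffP.
Qed.

Lemma abspow'_continuous p : 2 <= p -> continuous (abspow' p).
Proof.
move=> p2 y.
suff h0 : abspow' p z @[z --> (0 : R)] --> abspow' p 0.
  have [->|y0] := eqVneq y 0; first exact: h0.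
  apply: cvgM; first by apply: cvgM; [exact: cvg_cst|exact: cvg_id].
  have ny0 : 0 < `|y| by rewrite normr_gt0.
  exact: (@continuous_comp _ _ _ (fun z : R => `|z|) (fun z : R => z `^ (p - 2)) y
    (@norm_continuous _ R y) (powR_gt0_continuous (p := p - 2) ny0)).
apply/cvgrPdist_le => /= e e0.
suff : \forall z \near (0 : R), `|abspow' p 0 - abspow' p z| <= e by [].
near=> z.
rewrite {1}/abspow' mulr0 mul0r sub0r normrN abspow'_norm//.
have z1 : `|z| <= 1.
  by near: z; exact: (@nbhs0_le _ R^o).
have ze : `|z| <= e / p.
  by near: z; apply: (@nbhs0_le _ R^o); rewrite divr_gt0//; lra.
have p0 : 0 < p by lra.
rewrite -ler_pdivlMl// mulrC; apply: le_trans ze.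
have [->|z0] := eqVneq z 0.
  by rewrite normr0 powR0//; apply/eqP; lra.
rewrite -[leRHS]powRr1//; apply: ger_powR; last by lra.
by rewrite normr_gt0 z0.
Unshelve. all: by end_near. Qed.

(** Young's inequality with exponents [p] and [p / (p - 1)], the second factor being
    written as a [p - 1]-st power. *)
Lemma young_powR p x y : 1 < p -> 0 <= x -> 0 <= y ->
  p * x * y `^ (p - 1) <= x `^ p + (p - 1) * y `^ p.
Proof.
move=> p1 x0 y0.
pose q := p / (p - 1).
have q0 : 0 < q by rewrite divr_gt0//; lra.
have p0 : 0 < p by exact: lt_trans p1.
have pq : p^-1 + q^-1 = 1 by rewrite /q; field; apply/andP; split; lra.
have := conjugate_powR x0 (powR_ge0 y (p - 1)) p0 q0 pq.
rewrite -powRrM (_ : (p - 1) * q = p); last by rewrite /q; field; lra.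
move=> h; rewrite -mulrA -ler_pdivlMl// (le_trans h)// /q le_eqVlt.
by apply/orP; left; apply/eqP; field; apply/andP; split; lra.
Qed.

End powers.

(** * The radial profile and the pointwise weight inequality *)

Section hyperbolic_inequalities.
Context (R : realType).
Implicit Types r : R.

Lemma sinh_gt0 r : 0 < r -> 0 < sinh r.
Proof.
by move=> r0; rewrite /sinh divr_gt0// subr_gt0 ltr_expR; lra.
Qed.

Lemma sinh_le_mul_cosh r : 0 <= r -> sinh r <= r * cosh r.
Proof.
move=> r0.
have df (s : R) : is_derive s 1 (fun s : R => s * cosh s - sinh s) (s * sinh s).
  have h := is_deriveB (is_derive_mul (@is_derive_id R _ s 1) (is_derive_cosh s))
    (is_derive_sinh s).
  by apply: (is_derive_eq h); ring.
rewrite -subr_ge0.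
rewrite (_ : 0 = 0 * cosh 0 - sinh 0); last first.
  by rewrite /sinh oppr0 subrr mul0r mul0r subrr.
apply: (@ger0_derive1_ndecr _ (fun s : R => s * cosh s - sinh s) 0 r) => //.
- move=> s; rewrite in_itv/= => /andP[s0 _]; rewrite derive1E.
  by have [_ ->] := df s; rewrite mulr_ge0// ltW// sinh_gt0.
- apply: continuous_subspaceT => s; apply: differentiable_continuous.
  by apply/derivable1_diffP; have [] := df s.
Qed.

Lemma inv_le_coth r : 0 < r -> r^-1 <= coth r.
Proof.
move=> r0; rewrite /coth ler_pdivlMr ?sinh_gt0// mulrC ler_pdivrMr//.
by rewrite mulrC sinh_le_mul_cosh// ltW.
Qed.
End hyperbolic_inequalities.

Section radial_profile.
Context (R : realType) (p : R) (N : nat).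
Hypotheses (hp : 2 <= p) (hN : 1 + p * (p - 1) <= N%:R).
Let a : R := N%:R - 1.
Let b : R := p - 1.

(** [h = - phi' / phi] for the ground state [phi = r^((p-1)/p) (sinh r)^(-(N-1)/p)], as a
    function of [q = cosh r]. *)
Definition logder (q : R) : R :=
  (a * (q / Num.sqrt (q ^+ 2 - 1)) - b / acosh q) / p.

(** The derivative of [h] with respect to [r]; the one with respect to [q] is
    [logder' q / sinh r]. *)
Definition logder' (q : R) : R :=
  (b / acosh q ^+ 2 - a / Num.sqrt (q ^+ 2 - 1) ^+ 2) / p.

Section pointwise.
Variable q : R.
Hypothesis q1 : 1 < q.
Let s := Num.sqrt (q ^+ 2 - 1).
Let r := acosh q.
Let h := logder q.

Let s0 : 0 < s. Proof. exact: sqrt_sqr_sub1_gt0. Qed.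
Let r0 : 0 < r. Proof. exact: acosh_gt0. Qed.
Let q0 : 0 < q. Proof. exact: lt_trans q1. Qed.
Let s2 : s ^+ 2 = q ^+ 2 - 1.
Proof. by rewrite sqr_sqrtr// subr_ge0 expr_ge1// ltW. Qed.
Let facts : [/\ 2 <= p, 1 <= b, 0 <= a - p * b, 2 * b <= a & 0 < p].
Proof.
have hp2 := hp; have b1 : 1 <= b by rewrite /b; lra.
have apb : 0 <= a - p * b.
  by rewrite (_ : _ - _ = N%:R - (1 + p * (p - 1))) ?subr_ge0// /a /b; ring.
have h2 : 2 * b <= p * b by rewrite ler_wpM2r//; lra.
by split => //; lra.
Qed.

Let cothE : coth r = q / s.
Proof. by rewrite /coth /r acoshK ?sinh_acosh// ltW. Qed.

Let c_r : r^-1 <= q / s. Proof. by rewrite -cothE; exact: inv_le_coth. Qed.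
Let c_S : s^-1 <= q / s.
Proof. by rewrite -[leLHS]mul1r; apply: ler_wpM2r; [rewrite invr_ge0|]; exact: ltW. Qed.

(** As [N - 1 >= p (p - 1) >= 2 (p - 1)] and [coth r >= 1 / r], one half of the
    [coth] term absorbs the negative term, and the other half is the bound. *)
Lemma logder_ge_inv : b / (p * r) <= h.
Proof.
have [hp2 b1 apb a2b p0] := facts.
rewrite /h /logder -/s -/r invfM mulrCA [leLHS]mulrC.
apply: ler_wpM2r; first by rewrite invr_ge0 ltW.
have c0 : 0 <= q / s by rewrite divr_ge0// ltW.
have h1 : 2 * b * (q / s) <= a * (q / s) by apply: ler_wpM2r.
have h2 : b / r <= b * (q / s) by apply: ler_wpM2l => //; lra.
lra.
Qed.

Lemma logder_ge_sinh : b / (p * s) <= h.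
Proof.
have [hp2 b1 apb a2b p0] := facts.
rewrite /h /logder -/s -/r invfM mulrCA [leLHS]mulrC.
apply: ler_wpM2r; first by rewrite invr_ge0 ltW.
have c0 : 0 <= q / s by rewrite divr_ge0// ltW.
have h1 : 2 * b * (q / s) <= a * (q / s) by apply: ler_wpM2r.
have h2 : b / r <= b * (q / s) by apply: ler_wpM2l => //; lra.
have h3 : b / s <= b * (q / s) by apply: ler_wpM2l => //; lra.
lra.
Qed.

Lemma logder_gt0 : 0 < h.
Proof.
have [hp2 b1 apb a2b p0] := facts.
by apply: lt_le_trans logder_ge_inv; rewrite divr_gt0 ?mulr_gt0// (lt_le_trans ltr01).
Qed.

Definition hardy_sum (r : R) : R :=
  (a / p) `^ p * hardy_weight p N r
  + (b `^ b * (N%:R * (p - 2) + 1) / p `^ p) / r `^ p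
  + (a * (a - p * b) * b `^ (p - 2) / p `^ p) / sinh r `^ p.

Let powR_split (z : R) : 0 <= z -> z `^ p = z `^ (p - 2) * z ^+ 2.
Proof.
have [hp2 b1 apb a2b p0] := facts.
move=> z0; have [->|zn] := eqVneq z 0.
  by rewrite expr0n mulr0 powR0//; apply/eqP; lra.
rewrite -powR_mulrn// -powRD; last by rewrite zn implybT.
by congr (_ `^ _); ring.
Qed.

(** The right side is [div V - (p - 1) |V|^(p / (p - 1))] for the radial field
    [V = h^(p-1) d/dr].  It equals [h^(p-2)] times a quadratic expression in
    [coth r] and [1 / r], in which [coth^2 r = 1 + 1 / sinh^2 r] is substituted.
    The term [((N - 1) / p)^2] gives the first weight exactly.  In the others,
    [coth r >= 1 / r] and [h^(p-2)] is bounded below through [h >= (p - 1) / (p r)]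
    or [h >= (p - 1) / (p sinh r)], which yields [1 / r^p] and [1 / sinh^p r]. *)
Lemma hardy_sum_le :
  hardy_sum r <= b * h `^ (p - 2) * logder' q
    + a * (q / s) * h `^ (p - 1) - b * h `^ p.
Proof.
have [hp2 b1 apb a2b p0] := facts.
have h0 := logder_gt0.
have b0 : 0 <= b by lra.
have pr0 := mulr_gt0 p0 r0.
have ps0 := mulr_gt0 p0 s0.
have hp1 : h `^ (p - 1) = h `^ (p - 2) * h.
  rewrite -[in LHS](@mulr_powRB1 _ _ (p - 1)) ?ltW//; last by lra.
  by rewrite mulrC; congr (_ `^ _ * _); ring.
rewrite hp1 (powR_split (ltW h0)).
set P := h `^ (p - 2).
have P0 : 0 <= P by exact: powR_ge0.
have rS : sinh r = s by rewrite /r sinh_acosh// ltW.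
have c2 : (q / s) ^+ 2 = 1 + s^-1 ^+ 2.
  have q2 : q ^+ 2 = s ^+ 2 + 1 by rewrite s2; ring.
  by rewrite exprMn q2; field; exact: lt0r_neq0.
have E1 : (a / p) `^ p * hardy_weight p N r = P * (a / p) ^+ 2.
  have a0 : 0 < a by lra.
  rewrite powR_split ?divr_ge0 ?ltW// /hardy_weight cothE mulrAC -powRM.
  - congr (_ `^ _ * _); rewrite /h /logder -/s -/r -/a -/b.
    by field; rewrite !lt0r_neq0.
  - by rewrite divr_ge0 ?ltW.
  - have h1 : b / a * r^-1 <= q / s.
      apply: le_trans c_r; apply: ler_piMl; first by rewrite invr_ge0 ltW.
      by rewrite ler_pdivrMr//; lra.
    by rewrite subr_ge0.
have E2 : (b `^ b * (N%:R * (p - 2) + 1) / p `^ p) / r `^ p <=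
    P * (a * b * (p - 2) / p ^+ 2 * (q / s) * r^-1 + b ^+ 2 / (p ^+ 2 * r ^+ 2)).
  have -> : (b `^ b * (N%:R * (p - 2) + 1) / p `^ p) / r `^ p =
      (b / (p * r)) `^ (p - 2) * (b * (a * (p - 2) + b) / (p ^+ 2 * r ^+ 2)).
    rewrite powRM ?invr_ge0 ?mulr_ge0 ?ltW//; last lra.
    rewrite (powR_split (ltW p0)) (powR_split (ltW r0)).
    rewrite -(powR_inv1 (mulr_ge0 (ltW p0) (ltW r0))) -powRrM mulN1r powRN powRM ?ltW//.
    rewrite (_ : b `^ b = b `^ (p - 2) * b); last first.
      rewrite mulrC -(@mulr_powRB1 _ b b); [|lra|lra].
      by congr (_ * _ `^ _); rewrite /b; ring.
    have pp : p `^ (p - 2) != 0 by rewrite lt0r_neq0// powR_gt0.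
    have rr : r `^ (p - 2) != 0 by rewrite lt0r_neq0// powR_gt0.
    have := lt0r_neq0 p0; have := lt0r_neq0 r0 => rn pn.
    rewrite /a /b. field; by rewrite pp rr pn rn.
  apply: ler_pM; rewrite ?powR_ge0//.
  - apply: divr_ge0; last by apply: mulr_ge0; exact: sqr_ge0.
    by apply: mulr_ge0 => //; apply: addr_ge0 => //; apply: mulr_ge0; lra.
  - apply: ge0_ler_powR; rewrite ?nnegrE; [lra| |exact: ltW|exact: logder_ge_inv].
    by apply: divr_ge0 => //; exact: ltW.
  - rewrite [leLHS](_ : _ = a * b * (p - 2) / p ^+ 2 * r^-1 * r^-1
        + b ^+ 2 / (p ^+ 2 * r ^+ 2)); last first.
      by field; rewrite !lt0r_neq0.
    rewrite lerD2r; apply: ler_wpM2r; first by rewrite invr_ge0 ltW.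
    apply: ler_wpM2l => //; apply: divr_ge0; last exact: sqr_ge0.
    by apply: mulr_ge0; [apply: mulr_ge0; lra|lra].
have E3 : (a * (a - p * b) * b `^ (p - 2) / p `^ p) / sinh r `^ p <=
    P * ((a * (a - p * b)) / p ^+ 2 * s^-1 ^+ 2).
  rewrite rS.
  have -> : (a * (a - p * b) * b `^ (p - 2) / p `^ p) / s `^ p =
      (b / (p * s)) `^ (p - 2) * ((a * (a - p * b)) / p ^+ 2 * s^-1 ^+ 2).
    rewrite powRM ?invr_ge0 ?mulr_ge0 ?ltW//; last lra.
    rewrite (powR_split (ltW p0)) (powR_split (ltW s0)).
    rewrite -(powR_inv1 (mulr_ge0 (ltW p0) (ltW s0))) -powRrM mulN1r powRN powRM ?ltW//.
    have pp : p `^ (p - 2) != 0 by rewrite lt0r_neq0// powR_gt0.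
    have rr : s `^ (p - 2) != 0 by rewrite lt0r_neq0// powR_gt0.
    have := lt0r_neq0 p0; have := lt0r_neq0 s0 => rn pn.
    field; by rewrite pp rr pn rn.
  apply: ler_wpM2r.
    apply: mulr_ge0; last exact: sqr_ge0.
    by apply: divr_ge0; [apply: mulr_ge0; lra|exact: sqr_ge0].
  apply: ge0_ler_powR; rewrite ?nnegrE; [lra| |exact: ltW|exact: logder_ge_sinh].
  by apply: divr_ge0 => //; exact: ltW.
rewrite /hardy_sum E1.
have -> : b * P * logder' q + a * (q / s) * (P * h) - b * (P * h ^+ 2) =
    P * (a / p) ^+ 2 + P * (a * b * (p - 2) / p ^+ 2 * (q / s) * r^-1 + b ^+ 2 / (p ^+ 2 * r ^+ 2))
    + P * ((a * (a - p * b)) / p ^+ 2 * s^-1 ^+ 2)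
    + P * (a / p) ^+ 2 * ((q / s) ^+ 2 - 1 - s^-1 ^+ 2).
  have := lt0r_neq0 p0; have := lt0r_neq0 r0; have := lt0r_neq0 s0 => Sn rn pn.
  rewrite /h /logder /logder' -/s -/r /b; field; by rewrite Sn rn pn.
rewrite c2; lra.
Qed.

End pointwise.
End radial_profile.

(** * The cut-off radial flux *)

Section cutoff.
Context (R : realType).
Implicit Types (n : nat) (q : R).

(** A C^1 cut-off in [q = cosh r]: zero near the pole [q = 1], nondecreasing in [q] and
    in [n], and tending to [1] off the pole.  Being nondecreasing in [r], it adds a
    term of favourable sign to the divergence, so that its derivative need not be
    small in any norm. *)
Definition cut n q : R :=
  pospart (n%:R * (q - 1) - 1) ^+ 2 / (1 + pospart (n%:R * (q - 1) - 1) ^+ 2).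

Definition cut' n q : R :=
  2 * n%:R * pospart (n%:R * (q - 1) - 1)
    / (1 + pospart (n%:R * (q - 1) - 1) ^+ 2) ^+ 2.

Lemma pospart_ge0 (y : R) : 0 <= pospart y.
Proof. by rewrite le_max lexx orbT. Qed.

Let den_gt0 (y : R) : 0 < 1 + pospart y ^+ 2.
Proof. by rewrite ltr_pwDl// sqr_ge0. Qed.

Lemma cut_ge0 n q : 0 <= cut n q.
Proof. by rewrite divr_ge0 ?sqr_ge0// ltW. Qed.

Lemma cut_le1 n q : cut n q <= 1.
Proof. by rewrite ler_pdivrMr// mul1r lerDr. Qed.

Lemma cut'_ge0 n q : 0 <= cut' n q.
Proof.
by rewrite divr_ge0 ?sqr_ge0// mulr_ge0 ?pospart_ge0// mulr_ge0.
Qed.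

Lemma cut_eq0 n q : n%:R * (q - 1) <= 1 -> cut n q = 0.
Proof.
by move=> nq; rewrite /cut /pospart max_r ?subr_le0// expr0n mul0r.
Qed.

Lemma cut'_eq0 n q : n%:R * (q - 1) <= 1 -> cut' n q = 0.
Proof.
by move=> nq; rewrite /cut' /pospart max_r ?subr_le0// mulr0 mul0r.
Qed.

Lemma is_derive_cut n q : is_derive q 1 (cut n) (cut' n q).
Proof.
pose l (q : R) := n%:R * (q - 1) - 1.
have dl : is_derive q 1 l n%:R.
  have h := is_deriveB (is_deriveZ (n%:R : R)
    (is_deriveB (@is_derive_id R _ q 1) (is_derive_cst (1 : R) q 1)))
    (is_derive_cst (1 : R) q 1).
  by apply: (is_derive_eq h); rewrite /GRing.scale/= !subr0 mulr1.
have dP : is_derive q 1 (fun q => pospart (l q) ^+ 2) (2 * pospart (l q) * n%:R).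
  exact: (@is_derive1_comp _ (fun y : R => pospart y ^+ 2) l q _ _
    (is_derive_sqr_pospart (l q)) dl).
have dD := is_deriveD (is_derive_cst (1 : R) q 1) dP.
have h := is_derive_mul dP (is_derive_inv dD (lt0r_neq0 (den_gt0 (l q)))).
apply: (is_derive_eq h); rewrite /cut' -/(l q).
by rewrite fctE /=; field; rewrite lt0r_neq0.
Qed.

Lemma pospart_continuous : continuous (@pospart R).
Proof.
have -> : @pospart R = fun y => (y + `|y|) / 2.
  apply/funext => y; rewrite /pospart; have [y0|y0] := leP y 0.
    by rewrite ler0_norm// subrr mul0r.
  by rewrite gtr0_norm//; field.
move=> y; apply: cvgM; last exact: cvg_cst.
by apply: cvgD; [exact: cvg_id|exact: norm_continuous].
Qed.

Lemma cut'_continuous n : continuous (cut' n).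
Proof.
move=> q; rewrite /cut'.
have h : pospart (n%:R * (z - 1) - 1) @[z --> q] --> pospart (n%:R * (q - 1) - 1).
  apply: (continuous_cvg _ (@pospart_continuous _)).
  apply: cvgB; last exact: cvg_cst.
  apply: cvgM; first exact: cvg_cst.
  by apply: cvgB; [exact: cvg_id|exact: cvg_cst].
have h2 : (1 + pospart (n%:R * (z - 1) - 1) ^+ 2) @[z --> q] -->
    (1 + pospart (n%:R * (q - 1) - 1) ^+ 2).
  by apply: cvgD; [exact: cvg_cst|apply: cvgM; exact: h].
apply: cvgM; first by apply: cvgM; [exact: cvg_cst|exact: h].
apply: cvgV; first by rewrite expf_neq0// lt0r_neq0.
by apply: cvgM; exact: h2.
Qed.

Lemma ler_cut q : 1 <= q -> {homo cut ^~ q : m n / (m <= n)%N >-> m <= n}.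
Proof.
move=> q1 m n mn; rewrite /cut.
set x := pospart _; set y := pospart _.
have xy : x ^+ 2 <= y ^+ 2.
  rewrite ler_pXn2r ?nnegrE ?pospart_ge0// /x /y /pospart.
  rewrite ge_max !le_max lexx orbT andbT lerD2r ler_wpM2r ?subr_ge0//.
  by rewrite ler_nat.
rewrite ler_pdivrMr ?den_gt0// mulrAC ler_pdivlMr ?den_gt0//.
by rewrite !mulrDr !mulr1 [y ^+ 2 * _]mulrC lerD2r.
Qed.

Lemma cvg_cut q : 1 < q -> cut n q @[n --> \oo] --> (1 : R).
Proof.
move=> q1; apply/cvgrPdist_le => /= e e0; near=> n.
have q0 : 0 < q - 1 by rewrite subr_gt0.
set P := pospart (n%:R * (q - 1) - 1).
have P1 : 0 < 1 + P ^+ 2 := den_gt0 _.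
have P_ge : e^-1 <= P.
  rewrite /P /pospart le_max lerBrDr -ler_pdivrMr//.
  by apply/orP; left; near: n; exact: nbhs_infty_ger.
have -> : 1 - cut n q = (1 + P ^+ 2)^-1.
  by rewrite /cut -/P; field; rewrite lt0r_neq0.
rewrite ger0_norm; last by rewrite invr_ge0 ltW.
rewrite -div1r ler_pdivrMr//.
have eP : 1 <= e * P by rewrite -ler_pdivrMl// mulr1.
apply: (le_trans eP); apply: ler_wpM2l; first exact: ltW.
by have := sqr_ge0 (P - 1); have := sqr_ge0 P; rewrite sqrrB1; lra.
Unshelve. all: by end_near. Qed.

End cutoff.

Section flux.
Context (R : realType) (p : R) (N : nat).
Hypotheses (hp : 2 <= p) (hN : 1 + p * (p - 1) <= N%:R).
Implicit Types (n : nat) (q : R).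

Local Notation s q := (Num.sqrt (q ^+ 2 - 1)).

(** [V = h^(p-1) d/dr = profile (cosh r) grad cosh r]: dividing by [sinh r] turns the
    unit radial field into the polynomial field [grad_cosh]. *)
Definition profile q : R := logder p N q `^ (p - 1) / s q.

Definition profile' q : R :=
  (p - 1) * logder p N q `^ (p - 2) * (logder' p N q / s q) / s q
  - logder p N q `^ (p - 1) * q / s q ^+ 3.

Let dsqrt q : 1 < q -> is_derive q 1 (fun q : R => s q) (q / s q).
Proof.
move=> q1; have s0 : 0 < q ^+ 2 - 1 by rewrite -sqrtr_gt0 sqrt_sqr_sub1_gt0.
have ds : is_derive q 1 (fun q : R => q ^+ 2 - 1) (2 * q).
  have h := is_deriveB (is_deriveX 2 (@is_derive_id R _ q 1)) (is_derive_cst (1 : R) q 1).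
  by apply: (is_derive_eq h); rewrite /GRing.scale/= expr1 mulr1; ring.
have h := @is_derive1_comp _ Num.sqrt (fun q : R => q ^+ 2 - 1) q _ _ (is_derive1_sqrt s0) ds.
apply: (is_derive_eq h); field.
by rewrite lt0r_neq0// sqrtr_gt0.
Qed.

Let s2 q : 1 < q -> s q ^+ 2 = q ^+ 2 - 1.
Proof. by move=> q1; rewrite sqr_sqrtr// ltW// -sqrtr_gt0 sqrt_sqr_sub1_gt0. Qed.

Lemma is_derive_logder q : 1 < q ->
  is_derive q 1 (logder p N) (logder' p N q / s q).
Proof.
move=> q1; have s0 := lt0r_neq0 (sqrt_sqr_sub1_gt0 q1).
have r0 := lt0r_neq0 (acosh_gt0 q1).
have dI := is_derive_inv (dsqrt q1) s0.
have dQ := is_deriveZ (N%:R - 1 : R) (is_derive_mul (@is_derive_id R _ q 1) dI).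
have dA := is_deriveZ (p - 1 : R) (is_derive_inv (is_derive_acosh q1) r0).
have h := is_derive_mul (is_deriveB dQ dA) (is_derive_cst p^-1 q 1).
apply: (is_derive_eq h); rewrite /logder' /GRing.scale/=.
have p0 : p != 0 by have := hp => ?; apply/eqP; lra.
have -> : 1 / s q + q * (- (q / s q) / s q ^+ 2) = (s q ^+ 2 - q ^+ 2) / s q ^+ 3.
  by field.
have -> : s q ^+ 2 - q ^+ 2 = -1 by rewrite s2//; ring.
rewrite mulr0 addr0; by field; rewrite p0 s0 r0.
Qed.

Lemma is_derive_profile q : 1 < q -> is_derive q 1 profile (profile' q).
Proof.
move=> q1; have s0 := lt0r_neq0 (sqrt_sqr_sub1_gt0 q1).
have h0 := logder_gt0 hp hN q1.
have dP := @is_derive1_comp _ (fun z : R => z `^ (p - 1)) (logder p N) q _ _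
  (is_derive1_powR (p - 1) h0) (is_derive_logder q1).
have h := is_derive_mul dP (is_derive_inv (dsqrt q1) s0).
apply: (is_derive_eq h); rewrite /profile' /=.
rewrite (_ : p - 1 - 1 = p - 2); last ring.
by field.
Qed.

Lemma profile'_continuous q : 1 < q -> profile' z @[z --> q] --> profile' q.
Proof.
move=> q1; have s0 := lt0r_neq0 (sqrt_sqr_sub1_gt0 q1).
have r0 := lt0r_neq0 (acosh_gt0 q1).
have h0 := logder_gt0 hp hN q1.
have cs : s z @[z --> q] --> s q := is_derive_cvg (dsqrt q1).
have csV : (s z)^-1 @[z --> q] --> (s q)^-1 by exact: cvgV.
have csV2 : (s z ^+ 2)^-1 @[z --> q] --> (s q ^+ 2)^-1.
  by apply: cvgV; [rewrite expf_neq0|apply: cvgM; exact: cs].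
have csV3 : (s z ^+ 3)^-1 @[z --> q] --> (s q ^+ 3)^-1.
  by apply: cvgV; [rewrite expf_neq0|do 2! apply: cvgM => //; exact: cs].
have cl : logder p N z @[z --> q] --> logder p N q := is_derive_cvg (is_derive_logder q1).
have cr : acosh z @[z --> q] --> acosh q := is_derive_cvg (is_derive_acosh q1).
have crV2 : (acosh z ^+ 2)^-1 @[z --> q] --> (acosh q ^+ 2)^-1.
  by apply: cvgV; [rewrite expf_neq0|apply: cvgM; exact: cr].
have cl' : logder' p N z @[z --> q] --> logder' p N q.
  apply: cvgM; last exact: cvg_cst.
  by apply: cvgB; apply: cvgM => //; exact: cvg_cst.
have cpow e : logder p N z `^ e @[z --> q] --> logder p N q `^ e.
  exact: (continuous_cvg _ (powR_gt0_continuous (p := e) h0)).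
apply: cvgB.
  apply: cvgM => //; apply: cvgM; last exact: cvgM.
  by apply: cvgM; [exact: cvg_cst|exact: cpow].
by apply: cvgM => //; apply: cvgM; [exact: cpow|exact: cvg_id].
Qed.

Definition flux n q : R := cut n q * profile q.
Definition flux' n q : R := cut' n q * profile q + cut n q * profile' q.

Let near_cut0 n q : q <= 1 -> \forall z \near q, n%:R * (z - 1) <= 1.
Proof.
move=> q1; have [->|n0] := eqVneq n O.
  by near=> z; rewrite mul0r.
have n0R : (0 : R) < n%:R by rewrite ltr0n lt0n.
near=> z; rewrite mulrC -ler_pdivlMr// lerBlDr ltW//.
by near: z; apply: lt_nbhsl; rewrite (le_lt_trans q1)// ltrDr divr_gt0.
Unshelve. all: by end_near. Qed.

Lemma is_derive_flux n q : is_derive q 1 (flux n) (flux' n q).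
Proof.
have [q1|q1] := ltP 1 q.
  exact: (is_derive_eq (is_derive_mul (is_derive_cut n q) (is_derive_profile q1))).
have nq := nbhs_singleton (near_cut0 n q1).
rewrite /flux' cut_eq0// cut'_eq0// !mul0r addr0.
apply: (@near_eq_is_derive _ _ _ (cst 0)).
near=> z; rewrite /flux cut_eq0 ?mul0r//.
by near: z; exact: near_cut0.
Unshelve. all: by end_near. Qed.

Lemma flux'_continuous n : continuous (flux' n).
Proof.
move=> q; have [q1|q1] := ltP 1 q.
  have c1 := is_derive_cvg (is_derive_profile q1).
  have c2 := is_derive_cvg (is_derive_cut n q).
  have c3 := profile'_continuous q1.
  apply: cvgD; apply: cvgM => //.
  exact: cut'_continuous.
have nq := nbhs_singleton (near_cut0 n q1).
suff : flux' n z @[z --> q] --> flux' n q by [].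
rewrite {2}/flux' cut_eq0// cut'_eq0// !mul0r addr0.
apply: (@cvg_near_cst _ _ _ _ (nbhs q)); near=> z.
rewrite /flux' cut_eq0 ?cut'_eq0 ?mul0r ?addr0//; near: z; exact: near_cut0.
Unshelve. all: by end_near. Qed.

Lemma flux_continuous n : continuous (flux n).
Proof. by move=> q; exact: is_derive_cvg (is_derive_flux n q). Qed.

(** The pointwise inequality to be integrated.  [G] stands for [|grad u|] and [E] for
    [<grad cosh r, grad u>], so that the last two terms form the divergence of
    [cut |u|^p V].  Young's inequality bounds the one with [E] by
    [cut (G^p + (p-1) h^p |u|^p)], with [cut G^p <= G^p]; the term with the derivative
    of [cut] is nonnegative; [hardy_sum_le] does the rest. *)
Lemma flux_ineq n q (u G E : R) : 1 <= q -> 0 <= G -> `|E| <= s q * G ->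
  cut n q * (hardy_sum p N (acosh q) * `|u| `^ p) <=
  G `^ p + ((flux' n q * (q ^+ 2 - 1) + N%:R * q * flux n q) * abspow p u
            + flux n q * (abspow' p u * E)).
Proof.
have hp2 := hp.
rewrite le_eqVlt => /predU1P[<-|q1] G0 EG.
  rewrite /flux' /flux cut_eq0 ?cut'_eq0 ?subrr ?mulr0//.
  by rewrite !(mul0r, mulr0, addr0) powR_ge0.
have s0 := sqrt_sqr_sub1_gt0 q1.
have h0 := logder_gt0 hp hN q1.
have hle := hardy_sum_le hp hN q1.
have c0 := cut_ge0 n q; have c1 := cut_le1 n q; have c'0 := cut'_ge0 n q.
set U := `|u| `^ p.
have U0 : 0 <= U by exact: powR_ge0.
have hp0 : 0 <= logder p N q `^ (p - 1) by exact: powR_ge0.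
have p1 : 1 < p by lra.
set h := logder p N q; set P := h `^ (p - 1).
have y := young_powR p1 G0 (mulr_ge0 (ltW h0) (normr_ge0 u)).
rewrite !(powRM _ (ltW h0) (normr_ge0 u)) -/h -/U -/P in y.
set V := `|u| `^ (p - 1) in y.
have V0 : 0 <= V by exact: powR_ge0.
have E1 : `|flux n q * (abspow' p u * E)| <=
    cut n q * (G `^ p + (p - 1) * (h `^ p * U)).
  rewrite normrM (normrM (abspow' p u)) abspow'_norm// -/V.
  have -> : `|flux n q| = cut n q * (P / s q).
    by rewrite ger0_norm// mulr_ge0// divr_ge0// ltW.
  rewrite -(mulrA (cut n q)); apply: ler_wpM2l => //.
  apply: (le_trans _ y).
  rewrite (_ : p * G * (P * V) = P * ((s q)^-1 * (p * (V * (s q * G))))); last first.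
    by field; exact: lt0r_neq0.
  rewrite -(mulrA P); apply: ler_wpM2l => //; apply: ler_wpM2l; first by rewrite invr_ge0 ltW.
  by rewrite -mulrA; apply: ler_wpM2l; [lra|exact: ler_wpM2l].
have E2 : (flux' n q * (q ^+ 2 - 1) + N%:R * q * flux n q) * U =
   cut' n q * (P * s q) * U + cut n q * ((p - 1) * h `^ (p - 2) * logder' p N q
    + (N%:R - 1) * (q / s q) * P) * U.
  rewrite /flux' /flux /profile /profile' -/h -/P.
  move: (s2 q1) (lt0r_neq0 s0); set S := s q => <- Sn0.
  by field.
have E3 : cut n q * (hardy_sum p N (acosh q) * U) <=
    cut n q * (((p - 1) * h `^ (p - 2) * logder' p N q
    + (N%:R - 1) * (q / s q) * P - (p - 1) * h `^ p) * U).
  by apply: ler_wpM2l => //; exact: ler_wpM2r.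
have E4 : cut n q * G `^ p <= G `^ p by rewrite ler_piMl ?powR_ge0.
have E5 : 0 <= cut' n q * (P * s q) * U.
  by apply: mulr_ge0 => //; apply: mulr_ge0 => //; apply: mulr_ge0 => //; exact: ltW.
move: E1; rewrite ler_norml => /andP[E1 _].
rewrite /abspow -/U E2.
apply: (le_trans E3).
lra.
Qed.

End flux.

(** * The vector field and its divergence *)

Lemma measurable_row_of_on (R : realType) (n : nat) (O : set 'rV[R]_n)
    (f : 'rV[R]_n -> R) : open O ->
  (forall x, O x -> f y @[y --> x] --> f x) ->
  measurable_fun (@row_of R n @^-1` O) (f \o @row_of R n).
Proof.
move=> oO cf; apply: (measurability _ (RGenOpens.measurableE R)).
move=> _ [_ [a [b ->] <-]].
rewrite (_ : _ `&` _ = @row_of R n @^-1` (O `&` f @^-1` `]a, b[%classic)) //.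
apply: measurable_row_of_open.
rewrite openE => x [Ox fx]; apply: filterI; first exact: open_nbhs_nbhs.
by apply: cf => //; apply: open_nbhs_nbhs; split => //; exact: interval_open.
Qed.

Lemma cvg_row (R : realType) (n : nat) (T : Type) (F : set_system T)
    {FF : Filter F} (f : T -> 'rV[R]_n) (x : 'rV[R]_n) :
  (forall i, f t ord0 i @[t --> F] --> x ord0 i) -> f @ F --> x.
Proof.
move=> fx; apply/cvgrPdist_le => /= e e0; near=> t.
rewrite [leLHS]/Num.Def.normr/= mx_normrE (bigmax_le _ (ltW e0))//= => -[i j] _.
rewrite !mxE/= ord1.
move: j; near: t; apply: filter_forall => j.
exact: ((cvgrPdist_le _ _).1 (fx j)).
Unshelve. all: by end_near. Qed.

Lemma cvg_exp (R : realType) (T : Type) (F : set_system T)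
    {FF : Filter F} (f : T -> R) (a : R) m :
  f @ F --> a -> f t ^+ m @[t --> F] --> a ^+ m.
Proof.
move=> fa; elim: m => [|m ih]; first exact: cvg_cst.
by rewrite exprS; under eq_cvg do rewrite exprS; exact: cvgM.
Qed.

(** Continuity is required on the open set [O] only, where the formulas make sense;
    off the closed set [K] the function vanishes near every point. *)
Lemma continuous_zero_off (R : realType) (n : nat) (O K : set 'rV[R]_n)
    (f : 'rV[R]_n -> R) : closed K -> K `<=` O ->
  (forall x, O x -> f y @[y --> x] --> f x) ->
  (forall x, ~ K x -> f x = 0) -> continuous f.
Proof.
move=> cK KO cf f0 x; have [Kx|Kx] := pselect (K x); first exact/cf/KO.
suff : f y @[y --> x] --> f x by [].
rewrite (f0 _ Kx); apply: (@cvg_near_cst _ _ _ _ (nbhs x)).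
have : nbhs x (~` K) by apply: open_nbhs_nbhs; split => //; exact: closed_openC.
by apply: filterS => y Ky; rewrite f0.
Qed.

Section test_functions.
Context (R : realType) (N : nat) (u : 'rV[R]_N -> R).
Hypothesis hu : test_function (@hyp_space R N) u.

Definition supp : set 'rV[R]_N := closure [set x | u x != 0].

Lemma supp_closed : closed supp. Proof. exact: closed_closure. Qed.

Lemma supp_compact : compact supp. Proof. by case: hu. Qed.

Lemma supp_ball : supp `<=` @hyp_space R N. Proof. by case: hu. Qed.

Lemma off_supp x : ~ supp x -> u x = 0.
Proof. by apply: contra_notP => /eqP ux; exact: subset_closure. Qed.

Lemma off_supp_near x : ~ supp x -> \forall y \near x, ~ supp y.
Proof.
move=> Kx; apply: open_nbhs_nbhs; split => //.
exact: closed_openC supp_closed.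
Qed.

Lemma off_supp_derive x v : ~ supp x -> 'D_v u x = 0.
Proof.
move=> Kx; rewrite (@near_eq_derive _ _ _ u (cst 0)) ?derive_cst//.
by near=> y; apply: off_supp; near: y; exact: off_supp_near.
Unshelve. all: by end_near. Qed.

Lemma off_supp_partials x : ~ supp x -> partials u x = 0.
Proof. by move=> Kx; apply/rowP => i; rewrite !mxE off_supp_derive. Qed.

Lemma test_continuous : continuous u.
Proof.
by case: hu => su _ _ x; apply: differentiable_continuous; exact: (su [::]).
Qed.

Lemma test_is_derive x v : is_derive x v u ('D_v u x).
Proof. by case: hu => su _ _; apply/derivableP/diff_derivable; exact: (su [::]). Qed.

Lemma cvg_partials x : partials u y @[y --> x] --> partials u x.
Proof.
apply: (@cvg_row _ _ _ (nbhs x) _ (partials u)) => i.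
rewrite mxE; under eq_cvg do rewrite mxE.
case: hu => su _ _.
exact: (differentiable_continuous (su [:: delta_mx ord0 i] x)).
Qed.

End test_functions.

(** The continuity of [field_deriv] below, over arbitrary convergent factors: with the
    factors kept abstract, unification does not unfold them. *)
Lemma cvg_field_expr (R : realType) (T : Type) (F : set_system T)
    {FF : Filter F} (CN C X_ XV V K P X D K' P' D_ : T -> R)
    (cn c x_ xv v k0 p0 x d k1 p1 d_ : R) (N : nat) (a : R) :
  CN @ F --> cn -> C @ F --> c -> X_ @ F --> x_ -> XV @ F --> xv ->
  V @ F --> v -> K @ F --> k0 -> P @ F --> p0 -> X @ F --> x -> D @ F --> d ->
  K' @ F --> k1 -> P' @ F --> p1 -> D_ @ F --> d_ ->
  CN t * ((N%:R * (2 * X_ t * XV t)) * V t * (K t * P t)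
    + (1 - X t + D t) / a * (K t * P t)
    + V t * (K' t * (C t ^+ 2 * V t) * P t + K t * (P' t * D_ t)))
  @[t --> F] -->
  cn * ((N%:R * (2 * x_ * xv)) * v * (k0 * p0)
    + (1 - x + d) / a * (k0 * p0)
    + v * (k1 * (c ^+ 2 * v) * p0 + k0 * (p1 * d_))).
Proof.
move=> hcn hc hx_ hxv hv hk hp hx hd hk' hp' hd_.
apply: cvgM => //; apply: cvgD; last first.
  apply: cvgM => //; apply: cvgD.
    apply: cvgM => //; apply: cvgM => //; apply: cvgM => //.
    by apply: cvgM; exact: hc.
  by apply: cvgM => //; exact: cvgM.
apply: cvgD.
  apply: cvgM; last exact: cvgM.
  apply: cvgM => //; apply: cvgM; first exact: cvg_cst.
  by apply: cvgM => //; apply: cvgM => //; exact: cvg_cst.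
apply: cvgM; last exact: cvgM.
apply: cvgM; last exact: cvg_cst.
by apply: cvgD => //; apply: cvgB => //; exact: cvg_cst.
Qed.

Section divergence_identity.
Context (R : realType) (p : R) (N : nat).
Hypotheses (hp : 2 <= p) (hN : 1 + p * (p - 1) <= N%:R).
Context (x0 : 'rV[R]_N) (hx0 : hyp_space x0).
Context (u : 'rV[R]_N -> R) (hu : test_function (@hyp_space R N) u).
Variable n : nat.

Local Notation Q := (hyp_cosh x0).
Local Notation k := (flux p N n).
Local Notation k' := (flux' p N n).

(** The [i]-th component of [conf ^+ N *: (cut |u|^p V)]: multiplying by the volume
    density turns the Riemannian divergence into the Euclidean one. *)
Definition field_comp (i : 'I_N) (x : 'rV[R]_N) : R :=
  conf x ^+ N * (grad_cosh x0 x ord0 i * (k (Q x) * abspow p (u x))).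

(** The [i]-th partial derivative of [field_comp i], as the Leibniz rule gives it. *)
Definition field_deriv (i : 'I_N) (x : 'rV[R]_N) : R :=
  conf x ^+ N *
   ((N%:R * (2 * x ord0 i / (1 - sqnorm x))) * grad_cosh x0 x ord0 i
      * (k (Q x) * abspow p (u x))
    + (1 - sqnorm x + sqnorm (x - x0)) / (1 - sqnorm x0)
      * (k (Q x) * abspow p (u x))
    + grad_cosh x0 x ord0 i
      * (k' (Q x) * (conf x ^+ 2 * grad_cosh x0 x ord0 i) * abspow p (u x)
         + k (Q x) * (abspow' p (u x) * partials u x ord0 i))).

Lemma field_comp_off i x : ~ supp u x -> field_comp i x = 0.
Proof. by move=> Kx; rewrite /field_comp (off_supp Kx) (abspow0 hp) !mulr0. Qed.

Lemma field_deriv_off i x : ~ supp u x -> field_deriv i x = 0.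
Proof.
move=> Kx; rewrite /field_deriv (off_supp Kx) off_supp_partials// !mxE (abspow0 hp).
by rewrite !(mulr0, addr0).
Qed.

Lemma is_derive_field i x :
  is_derive x (delta_mx ord0 i : 'rV[R]_N) (field_comp i) (field_deriv i x).
Proof.
have [Kx|Kx] := pselect (supp u x); last first.
  rewrite field_deriv_off//; apply: (@near_eq_is_derive _ _ _ (cst 0)).
  by near=> y; rewrite field_comp_off//; near: y; exact: off_supp_near.
have xU := supp_ball hu Kx.
pose e : 'rV[R]_N := delta_mx ord0 i.
have dC := is_derive_conf_exp N i xU.
have dV := is_derive_grad_cosh x0 x i.
have dQ := is_derive_hyp_cosh hx0 xU (@is_derive_id _ _ x e).
have dk := @is_derive_comp1 _ _ k (hyp_cosh x0) x e _ _ (is_derive_flux hp hN n (Q x)) dQ.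
have dphi := is_derive_comp1 (is_derive_abspow (u x) hp) (test_is_derive hu x e).
have h := is_derive_mul dC (is_derive_mul dV (is_derive_mul dk dphi)).
apply: (is_derive_eq h); rewrite /field_deriv dot_delta /=.
have -> : partials u x ord0 i = 'D_e u x by rewrite mxE.
ring.
Unshelve. all: by end_near. Qed.

Lemma field_deriv_continuous i : continuous (field_deriv i).
Proof.
apply: (continuous_zero_off (f := field_deriv i) (@supp_closed _ _ u) (supp_ball hu)); last first.
  by move=> x; exact: field_deriv_off.
move=> x xU; have x1 := hyp_spaceP xU.
have cid : (fun y : 'rV[R]_N => y) @ nbhs x --> x by exact: cvg_id.
have cC : conf y @[y --> x] --> conf x.
  exact: (cvg_conf (F := nbhs x) cid xU).
have cX : sqnorm y @[y --> x] --> sqnorm x.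
  exact: (cvg_sqnorm (F := nbhs x) cid).
have cD : sqnorm (y - x0) @[y --> x] --> sqnorm (x - x0).
  exact: (cvg_sqnormB (F := nbhs x) cid).
have cx : (fun y : 'rV[R]_N => y ord0 i) @ nbhs x --> x ord0 i.
  exact: coord_continuous.
have cV : grad_cosh x0 y ord0 i @[y --> x] --> grad_cosh x0 x ord0 i.
  apply: (@continuous_cvg _ _ _ (nbhs x) _ (grad_cosh x0)
    (fun z : 'rV[R]_N => z ord0 i) (grad_cosh x0 x)).
    exact: coord_continuous.
  exact: (cvg_grad_cosh (F := nbhs x) cid).
have cQ : Q y @[y --> x] --> Q x.
  exact: (cvg_hyp_cosh (F := nbhs x) cid hx0 xU).
have ck : k (Q y) @[y --> x] --> k (Q x).
  exact: (@continuous_cvg _ _ _ (nbhs x) _ Q k (Q x)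
    (@flux_continuous _ _ _ hp hN n (Q x)) cQ).
have ck' : k' (Q y) @[y --> x] --> k' (Q x).
  exact: (@continuous_cvg _ _ _ (nbhs x) _ Q k' (Q x)
    (@flux'_continuous _ _ _ hp hN n (Q x)) cQ).
have cu : u y @[y --> x] --> u x by exact: test_continuous.
have cphi : abspow p (u y) @[y --> x] --> abspow p (u x).
  exact: (@continuous_cvg _ _ _ (nbhs x) _ u (abspow p) (u x)
    (@abspow_continuous _ _ hp (u x)) cu).
have cphi' : abspow' p (u y) @[y --> x] --> abspow' p (u x).
  exact: (@continuous_cvg _ _ _ (nbhs x) _ u (abspow' p) (u x)
    (@abspow'_continuous _ _ hp (u x)) cu).
have cp : partials u y ord0 i @[y --> x] --> partials u x ord0 i.
  apply: (@continuous_cvg _ _ _ (nbhs x) _ (partials u)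
    (fun z : 'rV[R]_N => z ord0 i) (partials u x)).
    exact: coord_continuous.
  exact: cvg_partials.
have cCN : conf y ^+ N @[y --> x] --> conf x ^+ N.
  exact: (@cvg_exp _ _ (nbhs x) _ (@conf R N) (conf x) N cC).
have cst1 (c : R) : (fun _ : 'rV[R]_N => c) @ nbhs x --> c by exact: cvg_cst.
have cX1 : (1 - sqnorm y) @[y --> x] --> (1 - sqnorm x).
  exact: (@cvgB _ _ _ (nbhs x) _ _ _ _ _ (cst1 1) cX).
have cXV : (1 - sqnorm y)^-1 @[y --> x] --> (1 - sqnorm x)^-1.
  exact: (@cvgV _ _ (nbhs x) _ (fun y : 'rV[R]_N => 1 - sqnorm y) _ (lt0r_neq0 x1) cX1).
exact: (cvg_field_expr (F := nbhs x) cCN cC cx cXV cV ck cphi cX cD ck' cphi' cp).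
Qed.

(** [div (k |u|^p grad cosh r)] with [k = flux (cosh r)]: the Laplacian and the squared
    gradient of [cosh r] produce the first two terms, the differential of [u] the third. *)
Lemma sum_field_deriv x : hyp_space x ->
  \sum_(i < N) field_deriv i x = conf x ^+ N *
    ((k' (Q x) * (Q x ^+ 2 - 1) + N%:R * Q x * k (Q x)) * abspow p (u x)
     + k (Q x) * (abspow' p (u x) * dot (grad_cosh x0 x) (partials u x))).
Proof.
move=> xU; rewrite /field_deriv -mulr_sumr; congr (_ * _).
set A := fun i : 'I_N => N%:R * (2 * x ord0 i / (1 - sqnorm x)).
set v := grad_cosh x0 x; set d := partials u x.
set b := (_ + _) / (_ - _).
transitivity (\sum_(i < N) ((A i * v ord0 i + b) * (k (Q x) * abspow p (u x))
   + (k' (Q x) * abspow p (u x) * conf x ^+ 2) * (v ord0 i * v ord0 i)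
   + (k (Q x) * abspow' p (u x)) * (v ord0 i * d ord0 i))).
  by apply: eq_bigr => i _; rewrite /A; ring.
rewrite !big_split/= -mulr_suml -!mulr_sumr laplace_cosh//.
rewrite -conf_grad_cosh// -dotxx /dot -/v; ring.
Qed.

End divergence_identity.

(** * Integration of the pointwise inequality *)

Section hardy.
Context (R : realType) (p : R) (N : nat).
Hypotheses (hp : 2 <= p) (hN : 1 + p * (p - 1) <= N%:R).
Context (x0 : 'rV[R]_N) (hx0 : hyp_space x0).
Context (u : 'rV[R]_N -> R) (hu : test_function (@hyp_space R N) u).

Local Notation Q := (hyp_cosh x0).
Local Notation mu := (lebesgue_tuple R N).
Local Notation row := (@row_of R N).
Local Notation ball := (@hyp_space R N).

(* The pole [x0] is taken out of the ball: the weights are continuous off it only, and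
   it is a null set. *)
Let D := row @^-1` ball.
Let P := ball `&` ~` [set x0].
Let D' := row @^-1` P.

(** The density of [|grad u|^p] with respect to the Lebesgue measure.  Off the support
    of [u] it is zero, also outside the ball, where [conf] has no meaning. *)
Definition energy (x : 'rV[R]_N) : R :=
  abspow p (Num.sqrt (sqnorm (partials u x)) / conf x) * conf x ^+ N.

Let mD : measurable D. Proof. exact: measurable_row_of_open (@open_hyp_space R N). Qed.

Let oP : open P.
Proof.
apply: openI; first exact: open_hyp_space.
apply: closed_openC; apply: accessible_closed_set1; apply: hausdorff_accessible.
exact: norm_hausdorff.
Qed.

Let mD' : measurable D'. Proof. exact: measurable_row_of_open oP. Qed.

Let Q_gt1 x : P x -> 1 < Q x.
Proof.
case=> xU /eqP xx0; rewrite lt_neqAle hyp_cosh_ge1// andbT.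
by rewrite eq_sym hyp_cosh_eq1.
Qed.

Let N_gt0 : (0 < N)%N.
Proof.
have hp2 := hp; have hN2 := hN.
rewrite lt0n; apply/eqP => N0; move: hN2; rewrite N0 => h.
have : 0 <= p * (p - 1) by apply: mulr_ge0; lra.
move: h; lra.
Qed.

Let point0 : mu (row @^-1` [set x0]) = 0%E.
Proof.
rewrite (_ : _ @^-1` _ = [set t | forall i, [set x0 ord0 i] (tnth t i)]); last first.
  apply/seteqP; split => t /=.
    by move=> tx i; have /rowP/(_ i) := tx; rewrite mxE.
  by move=> tx; apply/rowP => i; rewrite mxE.
rewrite (lebesgue_tuple_box (A := fun i => [set x0 ord0 i]))//.
rewrite (bigD1 (Ordinal N_gt0))//= lebesgue_measure_set1 mul0e.
by [].
Qed.

Let mpoint : measurable (row @^-1` [set x0]).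
Proof.
rewrite (_ : _ @^-1` _ = D `\` D'); first exact: measurableD.
apply/seteqP; split => t /=.
  by rewrite /D /D' /P /= => ->; split => // -[_]; exact.
by move=> [Dt nP]; apply: contrapT => tx; apply: nP; split.
Qed.

(* The density of [w (cosh r) |u|^p] with respect to the Lebesgue measure. *)
Let weighted (w : R -> R) (x : 'rV[R]_N) : R := w (Q x) * `|u x| `^ p * conf x ^+ N.

Let cvg_weighted (w : R -> R) x : P x -> (forall q : R, 1 < q -> w z @[z --> q] --> w q) ->
  weighted w y @[y --> x] --> weighted w x.
Proof.
move=> Px cw; have [xU _] := Px.
have cid : (fun y : 'rV[R]_N => y) @ nbhs x --> x by exact: cvg_id.
have cC : conf y @[y --> x] --> conf x.
  exact: (cvg_conf (F := nbhs x) cid xU).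
have cQ : Q y @[y --> x] --> Q x.
  exact: (cvg_hyp_cosh (F := nbhs x) cid hx0 xU).
have cwQ : w (Q y) @[y --> x] --> w (Q x).
  exact: (@continuous_cvg _ _ _ (nbhs x) _ Q w (Q x) (cw _ (Q_gt1 Px)) cQ).
have cu : u y @[y --> x] --> u x by exact: test_continuous.
have cphi : abspow p (u y) @[y --> x] --> abspow p (u x).
  exact: (@continuous_cvg _ _ _ (nbhs x) _ u (abspow p) (u x)
    (@abspow_continuous _ _ hp (u x)) cu).
have cCN : conf y ^+ N @[y --> x] --> conf x ^+ N.
  exact: (@cvg_exp _ _ (nbhs x) _ (@conf R N) (conf x) N cC).
exact: (@cvgM _ _ (nbhs x) _ _ _ _ _ (@cvgM _ _ (nbhs x) _ _ _ _ _ cwQ cphi) cCN).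
Qed.

Let measurable_weighted (w : R -> R) : (forall q : R, 1 < q -> w z @[z --> q] --> w q) ->
  measurable_fun D' (EFin \o (weighted w \o row)).
Proof.
move=> cw; apply/measurable_EFinP; apply: measurable_row_of_on => // x Px.
exact: cvg_weighted.
Qed.

Let measurableD_of (f : N.-tuple (measurableTypeR R) -> \bar R) :
  measurable_fun D' f -> measurable_fun D f.
Proof.
move=> mf; rewrite (_ : D = D' `|` row @^-1` [set x0]).
  apply/measurable_funU => //; split => //.
  rewrite (_ : _ @^-1` _ = [set [tuple x0 ord0 i | i < N]]); first exact: measurable_fun_set1.
  apply/seteqP; split => t /=.
    move=> tx; apply: eq_from_tnth => i; rewrite tnth_mktuple.
    by have /rowP/(_ i) := tx; rewrite mxE.
  by move=> ->; apply/rowP => i; rewrite mxE tnth_mktuple.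
apply/seteqP; split => t; rewrite /D /D' /P /=.
  by move=> Dt; have [->|/eqP tx] := eqVneq (row t) x0; [right|left].
by case=> [[]//|->].
Qed.

Let integral_D' (w : R -> R) (w0 : forall x, ball x -> 0 <= w (hyp_dist x x0)) :
  (forall q : R, 1 < q -> w (acosh z) @[z --> q] --> w (acosh q)) ->
  hyp_integral (fun x : 'rV[R]_N => w (hyp_dist x x0) * `|u x| `^ p) =
  (\int[mu]_(t in D') (weighted (w \o @acosh R) (row t))%:E)%E.
Proof.
move=> cw.
transitivity (\int[mu]_(t in D) (weighted (w \o @acosh R) (row t))%:E)%E.
  apply: eq_integral => t; rewrite inE => Dt.
  by rewrite sqrt_det_hyp_metric// hyp_distE.
rewrite (ge0_negligible_integral mpoint mD _ _ point0).
- by congr (integral mu _ _).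
- exact: (measurableD_of (measurable_weighted cw)).
- move=> t Dt; rewrite lee_fin /weighted /= -hyp_distE// mulr_ge0//.
    by rewrite mulr_ge0 ?powR_ge0 ?w0.
  by rewrite exprn_ge0// ltW// conf_gt0.
Qed.

Let energy_off x : ~ supp u x -> energy x = 0.
Proof.
move=> Kx; rewrite /energy off_supp_partials//.
by rewrite (_ : sqnorm 0 = 0) ?sqrtr0 ?mul0r ?(abspow0 hp) ?mul0r//; apply/eqP; rewrite sqnorm_eq0.
Qed.

Let energy_continuous : continuous energy.
Proof.
apply: (continuous_zero_off (f := energy) (@supp_closed _ _ u) (supp_ball hu)) => //.
move=> x xU; have c0 := lt0r_neq0 (conf_gt0 xU).
have cid : (fun y : 'rV[R]_N => y) @ nbhs x --> x by exact: cvg_id.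
have cC : conf y @[y --> x] --> conf x.
  exact: (cvg_conf (F := nbhs x) cid xU).
have cp : sqnorm (partials u y) @[y --> x] --> sqnorm (partials u x).
  exact: (cvg_sqnorm (F := nbhs x) (cvg_partials hu (x := x))).
have cs : Num.sqrt (sqnorm (partials u y)) @[y --> x] --> Num.sqrt (sqnorm (partials u x)).
  exact: (@continuous_cvg _ _ _ (nbhs x) _ (fun y => sqnorm (partials u y)) Num.sqrt _
    (@sqrt_continuous R _) cp).
have cq : Num.sqrt (sqnorm (partials u y)) / conf y @[y --> x] -->
    Num.sqrt (sqnorm (partials u x)) / conf x.
  exact: (@cvgM _ _ (nbhs x) _ _ _ _ _ cs (@cvgV _ _ (nbhs x) _ (@conf R N) _ c0 cC)).
have cphi : abspow p (Num.sqrt (sqnorm (partials u y)) / conf y) @[y --> x] -->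
    abspow p (Num.sqrt (sqnorm (partials u x)) / conf x).
  exact: (@continuous_cvg _ _ _ (nbhs x) _
    (fun y => Num.sqrt (sqnorm (partials u y)) / conf y) (abspow p)
    (Num.sqrt (sqnorm (partials u x)) / conf x) (@abspow_continuous _ _ hp _) cq).
have cCN : conf y ^+ N @[y --> x] --> conf x ^+ N.
  exact: (@cvg_exp _ _ (nbhs x) _ (@conf R N) (conf x) N cC).
exact: (@cvgM _ _ (nbhs x) _ _ _ _ _ cphi cCN).
Qed.

Let integrable_of (f : 'rV[R]_N -> R) : continuous f ->
  (forall x, ~ supp u x -> f x = 0) -> mu.-integrable setT (EFin \o (f \o row)).
Proof.
move=> cf f0; apply: box_supported_integrable.
exact: (box_supported_row_of cf (supp_compact hu)).
Qed.

Lemma integral_energy :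
  hyp_integral (fun x => hyp_grad_norm u x `^ p) = (\int[mu]_t (energy (row t))%:E)%E.
Proof.
rewrite [RHS](_ : _ = \int[mu]_(t in D) (energy (row t))%:E)%E.
  apply: eq_integral => t; rewrite inE => Dt.
  rewrite sqrt_det_hyp_metric// hyp_grad_normE// /energy /abspow ger0_norm//.
  by rewrite divr_ge0 ?sqrtr_ge0// ltW// conf_gt0.
rewrite [RHS]integral_mkcond; apply: eq_integral => t _; rewrite patchE.
case: ifPn => //; rewrite notin_setE => Dt; rewrite energy_off// => /(supp_ball hu).
exact: Dt.
Qed.

Lemma integral_energy_lty : (\int[mu]_t (energy (row t))%:E < +oo)%E.
Proof.
have /integrableP[_] := integrable_of energy_continuous energy_off.
apply: le_lt_trans; apply: (le_trans (lee_abs _)).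
exact: (le_abse_integral mu measurableT
  (measurable_int _ (integrable_of energy_continuous energy_off))).
Qed.

(* The added divergence has integral zero, and makes the density of the energy
   pointwise comparable with the cut-off Hardy weights. *)
Let total n x : R := energy x + \sum_(i < N) field_deriv p x0 u n i x.

Let integral_total n :
  (\int[mu]_t (total n (row t))%:E = \int[mu]_t (energy (row t))%:E)%E.
Proof.
have int_deriv i : mu.-integrable setT (EFin \o (field_deriv p x0 u n i \o row)).
  apply: integrable_of; first exact: field_deriv_continuous.
  by move=> x; exact: field_deriv_off.
transitivity (\int[mu]_t ((energy (row t))%:E +
    \sum_(i < N) (field_deriv p x0 u n i (row t))%:E))%E.
  by apply: eq_integral => t _; rewrite /total EFinD sumEFin.
rewrite integralD//; last 2 first.
- exact: integrable_of energy_continuous energy_off.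
- apply: (@integrable_sum _ _ _ mu setT measurableT 'I_N _ xpredT
    (fun i t => (field_deriv p x0 u n i (row t))%:E)) => i _.
  exact: int_deriv.
rewrite (integral_sum measurableT int_deriv) big1 ?adde0// => i _.
apply: (@integral_partial_eq0 R N (field_comp p x0 u n i) _ (supp u) i).
- exact: field_deriv_continuous.
- exact: supp_compact hu.
- by move=> x Kx; rewrite field_comp_off// field_deriv_off.
- by move=> x; exact: is_derive_field.
Qed.

Let total_ge n x : ball x ->
  cut n (Q x) * weighted (hardy_sum p N \o @acosh R) x <= total n x.
Proof.
move=> xU; have c0 := conf_gt0 xU.
rewrite /total sum_field_deriv// /energy /weighted.
rewrite mulrA [X in _ <= X + _]mulrC -mulrDr [X in X <= _]mulrC.
apply: ler_wpM2l; first by rewrite exprn_ge0// ltW.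
set G := Num.sqrt _ / _.
have G0 : 0 <= G by rewrite divr_ge0 ?sqrtr_ge0// ltW.
rewrite {1}/abspow (ger0_norm G0); apply: flux_ineq => //.
  exact: hyp_cosh_ge1.
have := hyp_cosh_lip (partials u x) hx0 xU.
rewrite riem_normE// normrM ger0_norm ?sqr_ge0// => h.
rewrite -(ler_pM2l (exprn_gt0 2 c0)); apply: (le_trans h).
rewrite le_eqVlt; apply/orP; left; apply/eqP; rewrite /G; field.
exact: lt0r_neq0.
Qed.

Let coefs : [/\ 2 <= p, (0 : R) < N%:R - 1, 0 <= N%:R - 1 - p * (p - 1),
  0 <= (N%:R : R) * (p - 2) + 1 & 2 * (p - 1) <= N%:R - 1].
Proof.
have hp2 := hp.
have apb : 0 <= N%:R - 1 - p * (p - 1).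
  by rewrite (_ : _ - _ = N%:R - (1 + p * (p - 1))) ?subr_ge0//; ring.
have h2 : 2 * (p - 1) <= p * (p - 1) by rewrite ler_wpM2r//; lra.
split => //; try lra.
by apply: addr_ge0 => //; apply: mulr_ge0 => //; lra.
Qed.

Lemma coef_dist_ge0 : 0 <= (p - 1) `^ (p - 1) * (N%:R * (p - 2) + 1) / p `^ p.
Proof.
have [_ _ _ h _] := coefs.
by apply: divr_ge0; [apply: mulr_ge0; [exact: powR_ge0|]|exact: powR_ge0].
Qed.

Lemma coef_sinh_ge0 : 0 <= (N%:R - 1) * (N%:R - 1 - p * (p - 1)) * (p - 1) `^ (p - 2) / p `^ p.
Proof.
have [_ a0 h _ _] := coefs.
apply: divr_ge0; last exact: powR_ge0.
by apply: mulr_ge0; [apply: mulr_ge0 => //; exact: ltW|exact: powR_ge0].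
Qed.

Let w1_ge0 (r : R) : 0 <= hardy_weight p N r. Proof. exact: powR_ge0. Qed.
Let w2_ge0 (r : R) : 0 <= (r `^ p)^-1. Proof. by rewrite invr_ge0 powR_ge0. Qed.
Let w3_ge0 (r : R) : 0 <= (sinh r `^ p)^-1. Proof. by rewrite invr_ge0 powR_ge0. Qed.

Section weights.
Context (T : Type) (F : set_system T) {FF : Filter F}.
Variables (f : T -> R) (r : R).
Hypotheses (fr : f @ F --> r) (r0 : 0 < r).

Let cvg_w2 : (f z `^ p)^-1 @[z --> F] --> (r `^ p)^-1.
Proof.
apply: cvgV; first by rewrite lt0r_neq0// powR_gt0.
exact: (continuous_cvg _ (powR_gt0_continuous (p := p) r0)).
Qed.

Let cvg_sinh : sinh (f z) @[z --> F] --> sinh r.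
Proof. exact: (continuous_cvg _ (is_derive_cvg (is_derive_sinh r))). Qed.

Let cvg_w3 : (sinh (f z) `^ p)^-1 @[z --> F] --> (sinh r `^ p)^-1.
Proof.
have s0 := sinh_gt0 r0.
apply: cvgV; first by rewrite lt0r_neq0// powR_gt0.
exact: (continuous_cvg _ (powR_gt0_continuous (p := p) s0)).
Qed.

Let cvg_w1 : hardy_weight p N (f z) @[z --> F] --> hardy_weight p N r.
Proof.
have [hp2 a0 _ _ a2b] := coefs.
have base : 0 < coth r - (p - 1) / (N%:R - 1) * r^-1.
  have h := inv_le_coth r0; have rV : 0 < r^-1 by rewrite invr_gt0.
  have k1 : (p - 1) / (N%:R - 1) < 1 by rewrite ltr_pdivrMr//; lra.
  have : (p - 1) / (N%:R - 1) * r^-1 < 1 * r^-1 by rewrite ltr_pM2r.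
  lra.
apply: (@continuous_cvg _ _ _ _ _ (fun z => coth (f z) - (p - 1) / (N%:R - 1) * (f z)^-1)
  (fun z : R => z `^ (p - 2)) (coth r - (p - 1) / (N%:R - 1) * r^-1)).
  exact: powR_gt0_continuous.
apply: cvgB.
  apply: cvgM; first exact: (continuous_cvg _ (is_derive_cvg (is_derive_cosh r))).
  by apply: cvgV => //; rewrite lt0r_neq0// sinh_gt0.
apply: cvgM; first exact: cvg_cst.
by apply: cvgV => //; rewrite lt0r_neq0.
Qed.

Lemma cvg_weights : [/\ hardy_weight p N (f z) @[z --> F] --> hardy_weight p N r,
  (f z `^ p)^-1 @[z --> F] --> (r `^ p)^-1 &
  (sinh (f z) `^ p)^-1 @[z --> F] --> (sinh r `^ p)^-1].
Proof. by []. Qed.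

Lemma cvg_hardy_sum : hardy_sum p N (f z) @[z --> F] --> hardy_sum p N r.
Proof.
rewrite /hardy_sum; apply: cvgD; first apply: cvgD.
- by apply: cvgM => //; exact: cvg_cst.
- by apply: cvgM => //; exact: cvg_cst.
- by apply: cvgM => //; exact: cvg_cst.
Qed.
End weights.

Let hardy_sum_ge0 r : 0 <= hardy_sum p N r.
Proof.
rewrite /hardy_sum; apply: addr_ge0; first apply: addr_ge0.
- by apply: mulr_ge0 => //; exact: powR_ge0.
- by apply: mulr_ge0 => //; exact: coef_dist_ge0.
- by apply: mulr_ge0 => //; exact: coef_sinh_ge0.
Qed.

Let weighted_hs_ge0 x : ball x -> 0 <= weighted (hardy_sum p N \o @acosh R) x.
Proof.
move=> xU; apply: mulr_ge0; last by rewrite exprn_ge0// ltW// conf_gt0.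
by apply: mulr_ge0; [exact: hardy_sum_ge0|exact: powR_ge0].
Qed.

Let total_ge0 n x : 0 <= total n x.
Proof.
have [Kx|Kx] := pselect (supp u x).
  have xU := supp_ball hu Kx.
  apply: (le_trans _ (total_ge n xU)).
  by rewrite mulr_ge0 ?cut_ge0// weighted_hs_ge0.
rewrite /total energy_off// big1 ?addr0// => i _.
exact: field_deriv_off.
Qed.

Let cvg_acosh (q : R) : 1 < q -> acosh z @[z --> q] --> acosh q.
Proof. by move=> q1; exact: is_derive_cvg (is_derive_acosh q1). Qed.

Let hs_continuous (q : R) : 1 < q ->
  hardy_sum p N (acosh z) @[z --> q] --> hardy_sum p N (acosh q).
Proof.
by move=> q1; exact: (cvg_hardy_sum (F := nbhs q) (cvg_acosh q1) (acosh_gt0 q1)).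
Qed.

(** Monotone convergence in the cut-off parameter. *)
Lemma hardy_integral_le :
  (\int[mu]_(t in D') (weighted (hardy_sum p N \o @acosh R) (row t))%:E <=
   \int[mu]_t (energy (row t))%:E)%E.
Proof.
pose g n (t : N.-tuple (measurableTypeR R)) : \bar R :=
  (cut n (Q (row t)) * weighted (hardy_sum p N \o @acosh R) (row t))%:E.
have mg n : measurable_fun D' (g n).
  have cw (q : R) : 1 < q -> cut n z * hardy_sum p N (acosh z) @[z --> q] -->
      cut n q * hardy_sum p N (acosh q).
    move=> q1; have c1 : cut n z @[z --> q] --> cut n q := is_derive_cvg (is_derive_cut n q).
    exact: (@cvgM _ _ (nbhs q) _ _ _ _ _ c1 (hs_continuous q1)).
  rewrite (_ : g n = EFin \o (weighted (fun q => cut n q * hardy_sum p N (acosh q)) \o row)).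
    exact: (measurable_weighted cw).
  by apply/funext => t; rewrite /g /weighted /= !mulrA.
have g0 n t : D' t -> (0 <= g n t)%E.
  case=> tU _; rewrite lee_fin mulr_ge0 ?cut_ge0//; exact: weighted_hs_ge0.
have ndg t : D' t -> nondecreasing_seq (g ^~ t).
  move=> D't; have [tU _] := D't => m n mn; rewrite lee_fin; apply: ler_wpM2r.
    exact: weighted_hs_ge0.
  by apply: ler_cut => //; exact: hyp_cosh_ge1.
have glim t : D' t -> (weighted (hardy_sum p N \o @acosh R) (row t))%:E = limn (g ^~ t).
  move=> D't; apply/esym/cvg_lim => //.
  apply: cvg_EFin; first exact: nearW.
  rewrite -[X in _ --> X]mul1r; apply: cvgM; last exact: cvg_cst.
  by apply: cvg_cut; exact: Q_gt1.
have -> : (\int[mu]_(t in D') (weighted (hardy_sum p N \o @acosh R) (row t))%:E =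
    \int[mu]_(t in D') limn (g ^~ t))%E.
  by apply: eq_integral => t; rewrite inE => /glim.
rewrite (monotone_convergence mu mD' mg g0 ndg).
apply: lime_le.
  apply: ereal_nondecreasing_is_cvgn => m n mn; apply: ge0_le_integral => //.
  - by move=> t; exact: g0.
  - by move=> t Dt; exact: ndg.
apply: nearW => n; rewrite -(integral_total n).
have mt : measurable_fun setT (fun t => (total n (row t))%:E).
  rewrite (_ : (fun t => _) = (fun t => (energy (row t))%:E
      + (\sum_(i < N) field_deriv p x0 u n i (row t))%:E)%E); last first.
    by apply/funext => t; rewrite /total EFinD.
  apply: emeasurable_funD.
    exact: (measurable_int _ (integrable_of energy_continuous energy_off)).
  apply/measurable_EFinP; apply: measurable_sum => i.
  apply: measurable_row_of_continuous; exact: field_deriv_continuous.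
apply: (@le_trans _ _ (\int[mu]_(t in D') (total n (row t))%:E)%E).
  apply: ge0_le_integral => //.
  - by move=> t; exact: g0.
  - exact: measurable_funTS.
  - by move=> t [tU _]; rewrite lee_fin; exact: total_ge.
apply: ge0_subset_integral => //.
by move=> t _; rewrite lee_fin.
Qed.

Lemma hardy_split :
  (\int[mu]_(t in D') (weighted (hardy_sum p N \o @acosh R) (row t))%:E =
   (((N%:R - 1) / p) `^ p)%:E
     * hyp_integral (fun x => (hardy_weight p N (hyp_dist x x0) * `|u x| `^ p)%R)
   + (((p - 1) `^ (p - 1) * (N%:R * (p - 2) + 1) / p `^ p)%:E
     * hyp_integral (fun x => (`|u x| `^ p / hyp_dist x x0 `^ p)%R)
   + ((N%:R - 1) * (N%:R - 1 - p * (p - 1)) * (p - 1) `^ (p - 2) / p `^ p)%:E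
     * hyp_integral (fun x => (`|u x| `^ p / sinh (hyp_dist x x0) `^ p)%R)))%E.
Proof.
pose w2 (r : R) := (r `^ p)^-1; pose w3 (r : R) := (sinh r `^ p)^-1.
have wts (q : R) : 1 < q ->
    [/\ hardy_weight p N (acosh z) @[z --> q] --> hardy_weight p N (acosh q),
    w2 (acosh z) @[z --> q] --> w2 (acosh q) & w3 (acosh z) @[z --> q] --> w3 (acosh q)].
  by move=> q1; exact: (cvg_weights (F := nbhs q) (cvg_acosh q1) (acosh_gt0 q1)).
have cw1 (q : R) : 1 < q -> hardy_weight p N (acosh z) @[z --> q] --> hardy_weight p N (acosh q).
  by move=> q1; have [] := wts _ q1.
have cw2 (q : R) : 1 < q -> w2 (acosh z) @[z --> q] --> w2 (acosh q).
  by move=> q1; have [] := wts _ q1.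
have cw3 (q : R) : 1 < q -> w3 (acosh z) @[z --> q] --> w3 (acosh q).
  by move=> q1; have [] := wts _ q1.
rewrite (_ : (fun x => `|u x| `^ p / hyp_dist x x0 `^ p) =
    fun x => w2 (hyp_dist x x0) * `|u x| `^ p); last first.
  by apply/funext => x; rewrite mulrC.
rewrite (_ : (fun x => `|u x| `^ p / sinh (hyp_dist x x0) `^ p) =
    fun x => w3 (hyp_dist x x0) * `|u x| `^ p); last first.
  by apply/funext => x; rewrite mulrC.
rewrite (integral_D' (w := hardy_weight p N) (fun x _ => w1_ge0 _) cw1).
rewrite (integral_D' (w := w2) (fun x _ => w2_ge0 _) cw2).
rewrite (integral_D' (w := w3) (fun x _ => w3_ge0 _) cw3).
have wt_ge0 (w : R -> R) (w0 : forall r, 0 <= w r) t : D' t ->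
    (0 <= (weighted (w \o @acosh R) (row t))%:E)%E.
  case=> tU _; rewrite lee_fin; apply: mulr_ge0; last by rewrite exprn_ge0// ltW// conf_gt0.
  by apply: mulr_ge0; [exact: w0|exact: powR_ge0].
have m1 := measurable_weighted cw1; have m2 := measurable_weighted cw2.
have m3 := measurable_weighted cw3.
have L0 : 0 <= ((N%:R - 1) / p) `^ p by exact: powR_ge0.
rewrite -(ge0_integralZl_EFin mu mD' (wt_ge0 _ w1_ge0) m1 L0).
rewrite -(ge0_integralZl_EFin mu mD' (wt_ge0 _ w2_ge0) m2 coef_dist_ge0).
rewrite -(ge0_integralZl_EFin mu mD' (wt_ge0 _ w3_ge0) m3 coef_sinh_ge0).
have z1 t : D' t -> (0 <= (((N%:R - 1) / p) `^ p)%:E *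
    (weighted (hardy_weight p N \o @acosh R) (row t))%:E)%E.
  by move=> Dt; apply: mule_ge0; [rewrite lee_fin|exact: (wt_ge0 _ w1_ge0)].
have z2 t : D' t -> (0 <= ((p - 1) `^ (p - 1) * (N%:R * (p - 2) + 1) / p `^ p)%:E *
    (weighted (w2 \o @acosh R) (row t))%:E)%E.
  by move=> Dt; apply: mule_ge0; [rewrite lee_fin coef_dist_ge0|exact: (wt_ge0 _ w2_ge0)].
have z3 t : D' t -> (0 <= ((N%:R - 1) * (N%:R - 1 - p * (p - 1)) * (p - 1) `^ (p - 2) / p `^ p)%:E *
    (weighted (w3 \o @acosh R) (row t))%:E)%E.
  by move=> Dt; apply: mule_ge0; [rewrite lee_fin coef_sinh_ge0|exact: (wt_ge0 _ w3_ge0)].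
have mz1 := measurable_funeM (((N%:R - 1) / p) `^ p)%:E m1.
have mz2 := measurable_funeM ((p - 1) `^ (p - 1) * (N%:R * (p - 2) + 1) / p `^ p)%:E m2.
have mz3 := measurable_funeM
  ((N%:R - 1) * (N%:R - 1 - p * (p - 1)) * (p - 1) `^ (p - 2) / p `^ p)%:E m3.
rewrite -(ge0_integralD mu mD' z2 mz2 z3 mz3).
rewrite -(ge0_integralD mu mD' z1 mz1 _ (emeasurable_funD mz2 mz3)); last first.
  by move=> t Dt; apply: adde_ge0; [exact: z2|exact: z3].
apply: eq_integral => t _; rewrite -!EFinM -!EFinD; congr EFin.
by rewrite /weighted /hardy_sum /= /w2 /w3; ring.
Qed.

End hardy.

Theorem theorem2p5 (R : realType) (p : R) (N : nat)
    (hp : 2 <= p) (hN : 1 + p * (p - 1) <= N%:R)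
    (x0 : 'rV[R]_N) (hx0 : hyp_space x0)
    (u : 'rV[R]_N -> R) (hu : test_function (@hyp_space R N) u) :
  let r := fun x => hyp_dist x x0 in
  let Lambda := ((N%:R - 1) / p) `^ p in
  (hyp_integral (fun x => (hyp_grad_norm u x `^ p)%R)
     - Lambda%:E
       * hyp_integral (fun x => (hardy_weight p N (r x) * `|u x| `^ p)%R)
   >=
   ((p - 1) `^ (p - 1) * (N%:R * (p - 2) + 1) / p `^ p)%R%:E
     * hyp_integral (fun x => (`|u x| `^ p / r x `^ p)%R)
   + ((N%:R - 1) * (N%:R - 1 - p * (p - 1)) * (p - 1) `^ (p - 2) / p `^ p)%R%:E
     * hyp_integral (fun x => (`|u x| `^ p / sinh (r x) `^ p)%R))%E.
Proof.
cbv zeta; rewrite (integral_energy hp hu).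
have := hardy_integral_le hp hN hx0 hu; rewrite (hardy_split hp hN hx0 hu).
have := integral_energy_lty hp hu.
set A := (\int[_]_t _)%E; set I1 := (_ * hyp_integral (fun x => hardy_weight _ _ _ * _)%R)%E.
set I2 := ((_ * hyp_integral (fun x => `|u x| `^ p / hyp_dist x x0 `^ p)%R) + _)%E.
move=> Aoo le_energy.
have I1_ge0 : (0 <= I1)%E.
  apply: mule_ge0; first by rewrite lee_fin powR_ge0.
  by apply: integral_ge0 => t _; rewrite lee_fin !mulr_ge0 ?powR_ge0 ?sqrtr_ge0.
have I2_ge0 : (0 <= I2)%E.
  apply: adde_ge0; apply: mule_ge0.
  - by rewrite lee_fin coef_dist_ge0.
  - by apply: integral_ge0 => t _; rewrite lee_fin !mulr_ge0 ?invr_ge0 ?powR_ge0 ?sqrtr_ge0.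
  - by rewrite lee_fin coef_sinh_ge0.
  - by apply: integral_ge0 => t _; rewrite lee_fin !mulr_ge0 ?invr_ge0 ?powR_ge0 ?sqrtr_ge0.
(* The first Hardy integral is finite, being at most the energy, so that it can be
   moved across the inequality between extended reals. *)
rewrite leeBrDr; first by rewrite addeC.
rewrite ge0_fin_numE//; apply: le_lt_trans Aoo; apply: le_trans le_energy.
by rewrite leeDl.
Qed.
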